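(* Let $a<b$ be real numbers and $c\in(0,\pi)$ with $ac+b(\pi-c)=0$, let $q(x)=a$ for $x\in[0,c]$, $q(x)=b$ for $x\in(c,\pi]$, and let $M=\max\{|a|,b\}$. Let $n$ be a positive integer such that $M<(2n-1)/2$ if $n>1$, and $M\le 1/2$ if $n=1$. Put $I_n=[n^2-M,n^2+M]$. Then a number $\lambda\in I_n$ is an eigenvalue of $L(q)$ if and only if it is a root of the equation \[ \lambda-n^{2}+C_{2n}-\sum_{k=1}^{\infty}a_{k}(\lambda)=0 . \]
   Context: $L(q)$ is the operator in $L_2[0,\pi]$ generated by $-y''+q(x)y$ with the boundary conditions $y(0)=y(\pi)=0$. For $k\in\mathbb{Z}$, $C_k=\frac{1}{\pi}\int_0^\pi q(x)\cos kx\,dx$; for this potential $C_0=0$ and $C_k=\frac{a-b}{\pi k}\sin kc$ for $k\neq0$, $C_{-k}=C_k$. For fixed $n$ and $k\ge1$, \[ a_k(\lambda)=\sum\frac{C_{n_1}C_{n_2}\cdots C_{n_k}\bigl(C_{n_1+\cdots+n_k}-C_{n_1+\cdots+n_k+2n}\bigr)}{\prod_{j=1}^{k}\bigl[\lambda-(n+n_1+\cdots+n_j)^2\bigr]}, \] where the sum is over all $(n_1,\dots,n_k)\in\mathbb{Z}^k$ such that $n_1+\cdots+n_j\notin\{0,-2n\}$ for $j=1,\dots,k$. *)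

(* Defs.v *)
From Stdlib Require Import Reals ZArith List.
From Coquelicot Require Import Coquelicot.
Import ListNotations.
Open Scope R_scope.

(* The step potential: q(x) = a on (-oo, c], b on (c, +oo).
   Only its restriction to [0, pi] matters. *)
Definition q (a b c : R) (x : R) : R := if Rle_dec x c then a else b.

Definition Ccoef (a b c : R) (m : Z) : R :=
  / PI * RInt (fun x => q a b c x * cos (IZR m * x)) 0 PI.

(* lam is an eigenvalue of L(q): -y'' + q y = lam y on [0,pi], y(0)=y(pi)=0,
   with a nontrivial y that is C^1 and satisfies the equation classically
   away from the jump point c (i.e. y in the domain W^{2,2} of L(q)). *)
Definition is_eigenvalue (a b c lam : R) : Prop :=
  exists y y' : R -> R,
    (forall x, 0 <= x <= PI -> is_derive y x (y' x)) /\
    continuous y' c /\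
    (forall x, 0 <= x <= PI -> x <> c -> is_derive y' x ((q a b c x - lam) * y x)) /\
    y 0 = 0 /\ y PI = 0 /\
    (exists x, 0 <= x <= PI /\ y x <> 0).

Fixpoint psums (acc : Z) (l : list Z) : list Z :=
  match l with
  | [] => []
  | x :: t => (acc + x)%Z :: psums (acc + x)%Z t
  end.

Definition zsum (l : list Z) : Z := fold_right Z.add 0%Z l.

(* the summand of a_k(lam) at the index tuple l = (n_1,...,n_k);
   zero when the tuple is excluded from the sum *)
Definition aterm (a b c : R) (n : nat) (lam : R) (l : list Z) : R :=
  let nz := Z.of_nat n in
  let ps := psums 0 l in
  if forallb (fun s => andb (negb (Z.eqb s 0)) (negb (Z.eqb s (- 2 * nz)))) ps then
    fold_right Rmult 1 (map (Ccoef a b c) l)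
      * (Ccoef a b c (zsum l) - Ccoef a b c (zsum l + 2 * nz))
      / fold_right Rmult 1 (map (fun s => lam - (IZR (nz + s)) ^ 2) ps)
  else 0.

Definition zrange (N : nat) : list Z :=
  map (fun i => (Z.of_nat i - Z.of_nat N)%Z) (seq 0 (2 * N + 1)).

Fixpoint tuples (N k : nat) : list (list Z) :=
  match k with
  | O => [[]]
  | S k' => flat_map (fun x => map (cons x) (tuples N k')) (zrange N)
  end.

Definition a_box (a b c : R) (n k : nat) (lam : R) (N : nat) : R :=
  fold_right Rplus 0 (map (aterm a b c n lam) (tuples N k)).

(* lam is a root of lam - n^2 + C_{2n} - sum_{k>=1} a_k(lam) = 0, where each
   a_k(lam) is the (convergent) sum over Z^k and the series in k converges. *)
Definition is_root_eq (a b c : R) (n : nat) (lam : R) : Prop :=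
  exists (A : nat -> R) (Ssum : R),
    (forall k, (1 <= k)%nat -> is_lim_seq (a_box a b c n k lam) (A k)) /\
    is_series (fun k => A (S k)) Ssum /\
    lam - (INR n) ^ 2 + Ccoef a b c (2 * Z.of_nat n) - Ssum = 0.

(* Main.v *)
Require Import Defs.
From Stdlib Require Import Reals ZArith List Lra Lia Classical.
From Coquelicot Require Import Coquelicot.
Open Scope R_scope.

(** A function [y] with [y(0) = y(pi) = 0] and [- y'' + q y - lam y = tau sin nx] is the sum of
    its sine series, and its coefficients satisfy
    [(lam - m^2) y_m = sum_j (C_(j-m) - C_(j+m)) y_j - tau [m = n]].  Off the mode [n] this is a
    fixed-point equation for an operator which is a contraction of [l^2]: multiplication by [q]
    has norm at most [M], while [|lam - m^2| > M] for [m >= 1], [m <> n].  Iterating it and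
    substituting into the equation of mode [n] gives
    [(lam - n^2 + C_(2n) - sum_k a_k(lam)) y_n = - tau].
    An eigenfunction ([tau = 0]) has [y_n <> 0], since otherwise the contraction kills all its
    modes; hence [lam] is a root.  If [lam] is not an eigenvalue, the boundary value problem is
    solvable for [tau = 1], so the first factor is nonzero and [lam] is not a root. *)

(** Completeness of the sines enters through an explicit, uniformly convergent series for the
    Green's function of [- y''], obtained from the parabola and integrated against the bounded but
    discontinuous [y'']. Convergence of sequences is controlled in l^1, because coefficients decay
    like 1/j^2, and their size in l^2, through bounds on partial sums; the factor M of the
    contraction comes from the integral of q V W for sine polynomials V, W.

    The delicate point is a_k. It is a limit over boxes of steps n_j in Z^k, whereas the iteration
    runs over positive modes. With positions p_j = n + n_1 + ... + n_j a tuple becomes a walk on Z,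
    and a box lets each position range over a window centred at the previous one, so the truncation
    is not that of a fixed matrix. Evenness of C_k makes the limits odd in the starting position,
    which folds Z onto the positive modes and cancels position 0. The decay of C_k and the
    summability of 1/(lam - p^2) bound the truncation error uniformly in the starting position. *)

(** * Integration across the jump of the potential *)

Lemma RInt_continuous_correct (f : R -> R) (al be : R) :
  (forall x, Rmin al be <= x <= Rmax al be -> continuous f x) ->
  is_RInt f al be (RInt f al be).
Proof.
  intros H; apply (@RInt_correct R_CompleteNormedModule).
  apply (@ex_RInt_continuous R_CompleteNormedModule), H.
Qed.

Lemma is_RInt_ext_le (f g : R -> R) (u v l : R) :
  u <= v -> (forall x, u < x < v -> f x = g x) -> is_RInt f u v l -> is_RInt g u v l.
Proof.
  intros Huv H; apply is_RInt_ext; rewrite Rmin_left, Rmax_right by assumption; exact H.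
Qed.

(** Differentiability is asked only in the open interval because [c], where [y'] may have no
    two-sided derivative, will be an endpoint. [F] minus a primitive of a continuous extension of
    [f] has zero derivative inside, hence equal values at the two ends by the mean value theorem. *)
Lemma FTC_interior (F f : R -> R) (al be : R) :
  al <= be ->
  (forall x, al <= x <= be -> continuous F x) ->
  (forall x, al < x < be -> is_derive F x (f x)) ->
  (forall x, al <= x <= be -> continuous f x) ->
  is_RInt f al be (F be - F al).
Proof.
  intros Hle HF Hd Hf.
  destruct (C0_extension_le f al be Hf) as [g [Hg Hgf]]; simpl in g.
  assert (Hint : forall x, is_RInt g al x (RInt g al x)).
  { intros x; apply RInt_continuous_correct; intros z _; apply Hg. }
  assert (HP : forall x, is_derive (RInt g al) x (g x)).
  { intros x; apply (is_derive_RInt g (RInt g al) al x); [|apply Hg].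
    apply filter_forall; intros; apply Hint. }
  destruct (MVT_gen (fun x => F x - RInt g al x) al be (fun _ => 0)) as [z [_ Hz]].
  - rewrite Rmin_left, Rmax_right by assumption; intros x Hx.
    replace 0 with (f x - g x) by (rewrite Hgf; lra).
    apply (is_derive_minus F); [apply Hd; assumption | apply HP].
  - rewrite Rmin_left, Rmax_right by assumption; intros x Hx.
    apply continuity_pt_filterlim, (continuous_minus F); [now apply HF|].
    apply ex_derive_continuous; eexists; apply HP.
  - rewrite RInt_point in Hz; unfold zero in Hz; simpl in Hz.
    replace (F be - F al) with (RInt g al be) by lra.
    apply is_RInt_ext_le with g; [assumption | intros x Hx; apply Hgf; lra | apply Hint].
Qed.

Lemma q_left (a b c x : R) : x <= c -> q a b c x = a.
Proof. intros H; unfold q; destruct (Rle_dec x c); lra. Qed.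

Lemma q_right (a b c x : R) : c < x -> q a b c x = b.
Proof. intros H; unfold q; destruct (Rle_dec x c); lra. Qed.

(** On each side of [c] the integrand agrees, in the open interval, with a continuous function
    [k * f1 + f2]. Continuity of [F] at [c] lets the two increments add up. *)
Lemma FTC_step (a b c : R) (F f1 f2 : R -> R) (al be : R) :
  al <= be ->
  (forall x, al <= x <= be -> continuous F x) ->
  (forall x, al <= x <= be -> continuous f1 x) ->
  (forall x, al <= x <= be -> continuous f2 x) ->
  (forall x, al < x < be -> x <> c -> is_derive F x (q a b c x * f1 x + f2 x)) ->
  is_RInt (fun x => q a b c x * f1 x + f2 x) al be (F be - F al).
Proof.
  intros Hle HF H1 H2 Hd.
  assert (Hk : forall k u v, al <= u -> u <= v -> v <= be ->
      (forall x, u < x < v -> q a b c x = k /\ x <> c) ->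
      is_RInt (fun x => q a b c x * f1 x + f2 x) u v (F v - F u)).
  { intros k u v Hu Huv Hv Hq.
    apply is_RInt_ext_le with (fun x => k * f1 x + f2 x); [assumption | |].
    - intros x Hx; destruct (Hq x Hx) as [-> _]; reflexivity.
    - apply FTC_interior; [assumption | intros; apply HF; lra | |].
      + intros x Hx; destruct (Hq x Hx) as [<- Hxc]; apply Hd; [lra | assumption].
      + intros x Hx; apply (continuous_plus (fun x => k * f1 x)).
        * apply (continuous_scal_r k f1), H1; lra.
        * apply H2; lra. }
  destruct (Rle_lt_dec be c) as [Hbc | Hbc].
  { apply (Hk a); try lra; intros x Hx; split; [apply q_left|]; lra. }
  destruct (Rle_lt_dec c al) as [Hac | Hac].
  { apply (Hk b); try lra; intros x Hx; split; [apply q_right|]; lra. }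
  replace (F be - F al) with ((F c - F al) + (F be - F c)) by ring.
  apply (@is_RInt_Chasles R_NormedModule) with c.
  - apply (Hk a); try lra; intros x Hx; split; [apply q_left|]; lra.
  - apply (Hk b); try lra; intros x Hx; split; [apply q_right|]; lra.
Qed.

Lemma is_RInt_step (a b c be : R) (f : R -> R) :
  0 < c < be ->
  (forall x, 0 <= x <= be -> continuous f x) ->
  is_RInt (fun x => q a b c x * f x) 0 be (a * RInt f 0 c + b * RInt f c be).
Proof.
  intros Hc Hf.
  apply (@is_RInt_Chasles R_NormedModule (fun x => q a b c x * f x) 0 c be).
  - apply is_RInt_ext_le with (fun x => a * f x); [lra | |].
    + intros x Hx; rewrite q_left; lra.
    + apply (is_RInt_scal f), RInt_continuous_correct.
      rewrite Rmin_left, Rmax_right by lra; intros x Hx; apply Hf; lra.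
  - apply is_RInt_ext_le with (fun x => b * f x); [lra | |].
    + intros x Hx; rewrite q_right; lra.
    + apply (is_RInt_scal f), RInt_continuous_correct.
      rewrite Rmin_left, Rmax_right by lra; intros x Hx; apply Hf; lra.
Qed.

Lemma ex_RInt_step (a b c be : R) (f : R -> R) :
  0 < c < be ->
  (forall x, 0 <= x <= be -> continuous f x) ->
  ex_RInt (fun x => q a b c x * f x) 0 be.
Proof. intros Hc Hf; eexists; apply is_RInt_step; eassumption. Qed.

(** * Series and finite sums *)

Lemma is_series_sum (u : nat -> R) (l : R) :
  is_series u l <-> is_lim_seq (sum_f_R0 u) l.
Proof.
  split; intros H.
  - apply is_lim_seq_ext with (sum_n u); [intros; apply sum_n_Reals | exact H].
  - apply (is_lim_seq_ext _ (sum_n u)) in H; [exact H | intros; symmetry; apply sum_n_Reals].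
Qed.

Lemma is_series_mult_l (u : nat -> R) (k l : R) :
  is_series u l -> is_series (fun j => k * u j) (k * l).
Proof. apply (@is_series_scal R_AbsRing R_NormedModule k u l). Qed.

Lemma Series_sum (u : nat -> R) :
  ex_series u -> is_lim_seq (sum_f_R0 u) (Series u).
Proof. intros H; apply is_series_sum, Series_correct, H. Qed.

Lemma ex_series_dominated (u v : nat -> R) :
  (forall j, Rabs (u j) <= v j) -> ex_series v -> ex_series u.
Proof. intros H Hv; apply (ex_series_le u v); assumption. Qed.

Lemma sum_tail_dominated (u v : nat -> R) (N m : nat) :
  (forall j, Rabs (u j) <= v j) ->
  Rabs (sum_f_R0 u (m + N) - sum_f_R0 u N) <= sum_f_R0 v (m + N) - sum_f_R0 v N.
Proof.
  intros H; induction m as [|m IH]; simpl.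
  - rewrite !Rminus_diag, Rabs_R0; lra.
  - specialize (H (S (m + N))).
    replace (sum_f_R0 u (m + N) + u (S (m + N)) - sum_f_R0 u N)
      with (sum_f_R0 u (m + N) - sum_f_R0 u N + u (S (m + N))) by ring.
    eapply Rle_trans; [apply Rabs_triang | lra].
Qed.

(** A quantitative Weierstrass test: the right-hand side does not involve [u], so the tail bound is
    uniform over any family with the common majorant [v]. *)
Lemma Series_tail_dominated (u v : nat -> R) (N : nat) :
  (forall j, Rabs (u j) <= v j) -> ex_series v ->
  Rabs (Series u - sum_f_R0 u N) <= Series v - sum_f_R0 v N.
Proof.
  intros H Hv.
  assert (Hu : ex_series u) by (eapply ex_series_dominated; eassumption).
  assert (L1 : is_lim_seq (fun m => Rabs (sum_f_R0 u (m + N) - sum_f_R0 u N))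
      (Rabs (Series u - sum_f_R0 u N))).
  { apply (is_lim_seq_abs _ (Finite (Series u - sum_f_R0 u N))).
    apply is_lim_seq_minus'; [|apply is_lim_seq_const].
    apply -> is_lim_seq_incr_n; apply Series_sum, Hu. }
  assert (L2 : is_lim_seq (fun m => sum_f_R0 v (m + N) - sum_f_R0 v N)
      (Series v - sum_f_R0 v N)).
  { apply is_lim_seq_minus'; [|apply is_lim_seq_const].
    apply -> is_lim_seq_incr_n; apply Series_sum, Hv. }
  apply (is_lim_seq_le _ _ _ _ (fun m => sum_tail_dominated u v N m H) L1 L2).
Qed.

Lemma tail_to_0 (v : nat -> R) :
  ex_series v -> is_lim_seq (fun N => Series v - sum_f_R0 v N) 0.
Proof.
  intros Hv; replace 0 with (Series v - Series v) by ring.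
  apply is_lim_seq_minus'; [apply is_lim_seq_const | apply Series_sum, Hv].
Qed.

Lemma tail_lt (v : nat -> R) (eps : R) :
  ex_series v -> 0 < eps -> exists N, Series v - sum_f_R0 v N < eps.
Proof.
  intros Hv He.
  destruct (proj2 (is_lim_seq_spec _ _) (tail_to_0 v Hv) (mkposreal eps He)) as [N HN].
  exists N; specialize (HN N (Nat.le_refl N)); simpl in HN.
  apply Rabs_def2 in HN; lra.
Qed.

Lemma sum_le_Series (v : nat -> R) (N : nat) :
  (forall j, 0 <= v j) -> ex_series v -> sum_f_R0 v N <= Series v.
Proof.
  intros H Hv.
  assert (Rabs (Series v - sum_f_R0 v N) <= Series v - sum_f_R0 v N).
  { apply Series_tail_dominated; [intros j; rewrite Rabs_pos_eq; [lra | apply H] | exact Hv]. }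
  pose proof (Rabs_pos (Series v - sum_f_R0 v N)); lra.
Qed.

Lemma sum_scal (u : nat -> R) (k : R) (N : nat) :
  sum_f_R0 (fun j => k * u j) N = k * sum_f_R0 u N.
Proof. induction N as [|N IH]; simpl; [ring | rewrite IH; ring]. Qed.

Lemma sum_minus (u v : nat -> R) (N : nat) :
  sum_f_R0 (fun j => u j - v j) N = sum_f_R0 u N - sum_f_R0 v N.
Proof. induction N as [|N IH]; simpl; [ring | rewrite IH; ring]. Qed.

(* The term of index [0] is [/ 0 = 0]. *)
Lemma ex_series_inv_sqr : ex_series (fun j => / INR j ^ 2).
Proof.
  apply (ex_series_incr_n (fun j => / INR j ^ 2) 1).
  apply (ex_series_dominated _ (fun j => 2 * (/ INR (S j) - / INR (S (S j))))).
  - intros j; rewrite Nat.add_1_l, !S_INR; pose proof (pos_INR j).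
    rewrite Rabs_pos_eq; [|apply Rlt_le, Rinv_0_lt_compat; nra].
    apply Rminus_le_0.
    replace (2 * (/ (INR j + 1) - / (INR j + 1 + 1)) - / (INR j + 1) ^ 2)
      with (INR j * / ((INR j + 1) * (INR j + 1) * (INR j + 1 + 1))) by (field; lra).
    apply Rmult_le_pos; [lra | apply Rlt_le, Rinv_0_lt_compat, Rmult_lt_0_compat; nra].
  - exists (2 * (1 - 0)); apply is_series_sum.
    apply is_lim_seq_ext with (fun N => 2 * (1 - / INR (S (S N)))).
    + intros N; induction N as [|N IH].
      * simpl; field.
      * rewrite tech5, <- IH; ring.
    + apply is_lim_seq_mult'; [apply is_lim_seq_const|].
      apply is_lim_seq_minus'; [apply is_lim_seq_const|].
      replace (Finite 0) with (Rbar_inv p_infty) by reflexivity.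
      apply is_lim_seq_inv; [|discriminate].
      apply is_lim_seq_ext with (fun N => INR (N + 2)); [intros; f_equal; lia|].
      apply -> (is_lim_seq_incr_n INR 2); apply is_lim_seq_INR.
Qed.

(** * The Fourier series of the parabola *)

Definition cos_sum (N : nat) (x : R) : R :=
  sum_f_R0 (fun j => cos (INR j * x) * / INR j ^ 2) N.

Definition sin_sum (N : nat) (x : R) : R :=
  sum_f_R0 (fun j => sin (INR j * x) * / INR j) N.

Definition cos_series (x : R) : R := Series (fun j => cos (INR j * x) * / INR j ^ 2).

Lemma is_derive_cos_sum (N : nat) (x : R) : is_derive (cos_sum N) x (- sin_sum N x).
Proof.
  unfold cos_sum, sin_sum; induction N as [|N IH].
  - simpl; auto_derive; [trivial|]; rewrite !Rmult_0_l, sin_0; ring.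
  - assert (INR (S N) <> 0) by (apply not_0_INR; discriminate).
    cbn [sum_f_R0]; rewrite Ropp_plus_distr.
    apply (is_derive_plus (fun x => sum_f_R0 (fun j => cos (INR j * x) * / INR j ^ 2) N));
      [exact IH|].
    generalize dependent (INR (S N)); intros k Hk; auto_derive; [trivial|]; field; assumption.
Qed.

(** The [- 1] removes the term of index 0, which equals 1 in the cosine sum but is constantly 0 in
    [sin_sum]. *)
Lemma is_derive_sin_sum (N : nat) (x : R) :
  is_derive (sin_sum N) x (sum_f_R0 (fun j => cos (INR j * x)) N - 1).
Proof.
  unfold sin_sum; induction N as [|N IH].
  - simpl; auto_derive; [trivial|]; rewrite !Rmult_0_l, cos_0; ring.
  - assert (INR (S N) <> 0) by (apply not_0_INR; discriminate).
    cbn [sum_f_R0].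
    replace (sum_f_R0 (fun j => cos (INR j * x)) N + cos (INR (S N) * x) - 1)
      with (sum_f_R0 (fun j => cos (INR j * x)) N - 1 + cos (INR (S N) * x)) by ring.
    apply (is_derive_plus (fun x => sum_f_R0 (fun j => sin (INR j * x) * / INR j) N));
      [exact IH|].
    generalize dependent (INR (S N)); intros k Hk; auto_derive; [trivial|]; field; assumption.
Qed.

Lemma Dirichlet_kernel (N : nat) (x : R) :
  2 * sin (x / 2) * (sum_f_R0 (fun j => cos (INR j * x)) N - / 2) = sin ((INR N + / 2) * x).
Proof.
  induction N as [|N IH].
  - simpl; rewrite Rmult_0_l, cos_0; replace ((0 + / 2) * x) with (x / 2) by field; field.
  - cbn [sum_f_R0].
    replace (2 * sin (x / 2) * (sum_f_R0 (fun j => cos (INR j * x)) N + cos (INR (S N) * x) - / 2))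
      with (2 * sin (x / 2) * (sum_f_R0 (fun j => cos (INR j * x)) N - / 2)
            + 2 * sin (x / 2) * cos (INR (S N) * x)) by ring.
    rewrite IH.
    replace ((INR N + / 2) * x) with (INR (S N) * x - x / 2) by (rewrite S_INR; field).
    replace ((INR (S N) + / 2) * x) with (INR (S N) * x + x / 2) by field.
    rewrite sin_plus, sin_minus; ring.
Qed.

Lemma sin_nat_PI (j : nat) : sin (INR j * PI) = 0.
Proof.
  apply sin_eq_0_1; exists (Z.of_nat j); now rewrite INR_IZR_INZ.
Qed.

Lemma sin_sum_PI (N : nat) : sin_sum N PI = 0.
Proof.
  unfold sin_sum; induction N as [|N IH]; cbn [sum_f_R0].
  - simpl; rewrite Rmult_0_l, sin_0; ring.
  - rewrite IH, sin_nat_PI; ring.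
Qed.

Lemma cos_half_PI (N : nat) : cos ((INR N + / 2) * PI) = 0.
Proof.
  replace ((INR N + / 2) * PI) with (INR N * PI + PI / 2) by field.
  rewrite cos_plus, cos_PI2, sin_PI2, sin_nat_PI; ring.
Qed.

Lemma MVT_abs_le (f df : R -> R) (u v K : R) :
  u <= v ->
  (forall x, u <= x <= v -> is_derive f x (df x)) ->
  (forall x, u <= x <= v -> Rabs (df x) <= K) ->
  Rabs (f v - f u) <= K * (v - u).
Proof.
  intros Huv Hd HK.
  destruct (MVT_gen f u v df) as [z [Hz ->]]; rewrite ?Rmin_left, ?Rmax_right in * by assumption.
  - intros x Hx; apply Hd; lra.
  - intros x Hx; apply continuity_pt_filterlim, (ex_derive_continuous f).
    eexists; apply Hd, Hx.
  - rewrite Rabs_mult, (Rabs_pos_eq (v - u)) by lra.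
    apply Rmult_le_compat_r; [lra | apply HK, Hz].
Qed.

(* Integrating the Dirichlet kernel by parts gains a factor [/ (INR N + / 2)]. *)
Lemma sin_sum_bound (N : nat) (x0 x : R) :
  0 < x0 -> x0 <= x <= PI ->
  Rabs (sin_sum N x - (PI - x) / 2)
    <= (PI / (4 * sin (x0 / 2) ^ 2) + / (2 * sin (x0 / 2))) * / (INR N + / 2).
Proof.
  intros H0 Hx; pose proof PI_RGT_0 as HPI.
  set (s := sin (x0 / 2)); set (w := INR N + / 2).
  assert (Hw : 0 < w) by (unfold w; pose proof (pos_INR N); lra).
  assert (Hs : 0 < s) by (apply sin_gt_0; lra).
  assert (Hsu : forall u, x0 <= u <= PI -> s <= sin (u / 2)).
  { intros u Hu; apply sin_incr_1; lra. }
  (* [h] is the boundary term of the integration by parts of sin(w u) / (2 sin(u/2)). In the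
     derivative of [E] the kernel itself cancels, and only a term with a factor 1/w is left. *)
  set (h := fun u => cos (w * u) * / (2 * w * sin (u / 2))).
  set (E := fun u => sin_sum N u - (PI - u) / 2 + h u).
  assert (HE : Rabs (E PI - E x)
      <= / (4 * w * s ^ 2) * (PI - x)).
  { apply MVT_abs_le with (df := fun u => - (cos (w * u) * cos (u / 2)) * / (4 * w * sin (u / 2) ^ 2)).
    - lra.
    - intros u Hu; assert (Hsp : 0 < sin (u / 2)) by (specialize (Hsu u); lra).
      unfold E, h.
      replace (- (cos (w * u) * cos (u / 2)) * / (4 * w * sin (u / 2) ^ 2))
        with ((sum_f_R0 (fun j => cos (INR j * u)) N - 1 + / 2)
              + (- sin (w * u) * / (2 * sin (u / 2))
                 - cos (w * u) * cos (u / 2) * / (4 * w * sin (u / 2) ^ 2))).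
      + apply (is_derive_plus (fun u => sin_sum N u - (PI - u) / 2)).
        * replace (sum_f_R0 (fun j => cos (INR j * u)) N - 1 + / 2)
            with (sum_f_R0 (fun j => cos (INR j * u)) N - 1 - (- / 2)) by ring.
          apply (is_derive_minus (sin_sum N)); [apply is_derive_sin_sum|].
          auto_derive; [trivial|]; field.
        * auto_derive; [|change (u * / 2) with (u / 2); field; lra].
          apply Rgt_not_eq, Rmult_lt_0_compat; [lra|exact Hsp].
      + replace (sum_f_R0 (fun j => cos (INR j * u)) N - 1 + / 2)
          with (sin (w * u) * / (2 * sin (u / 2))).
        * field; lra.
        * unfold w; rewrite <- Dirichlet_kernel; field; lra.
    - intros u Hu; assert (Hsp : s <= sin (u / 2)) by (apply Hsu; lra).
      rewrite Rabs_mult, Rabs_Ropp, Rabs_mult.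
      assert (0 < 4 * w * s ^ 2) by (apply Rmult_lt_0_compat; [lra | nra]).
      assert (4 * w * s ^ 2 <= 4 * w * sin (u / 2) ^ 2)
        by (apply Rmult_le_compat_l; [lra | nra]).
      rewrite (Rabs_pos_eq (/ _)) by (apply Rlt_le, Rinv_0_lt_compat; lra).
      assert (Hcc : Rabs (cos (w * u)) * Rabs (cos (u / 2)) <= 1 * 1).
      { apply Rmult_le_compat; try apply Rabs_pos; apply Rabs_le, COS_bound. }
      rewrite <- (Rmult_1_l (/ (4 * w * s ^ 2))).
      apply Rmult_le_compat; [apply Rmult_le_pos; apply Rabs_pos
        | apply Rlt_le, Rinv_0_lt_compat; lra | lra |].
      apply Rinv_le_contravar; assumption. }
  (* The estimate is anchored at [PI], where [sin_sum], the linear term and, thanks to the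
     half-integer frequency, [h] all vanish. *)
  assert (HEP : E PI = 0).
  { unfold E, h; rewrite sin_sum_PI; unfold w; rewrite cos_half_PI; field.
    rewrite sin_PI2; pose proof (pos_INR N); lra. }
  rewrite HEP, Rminus_0_l, Rabs_Ropp in HE.
  assert (Hh : Rabs (h x) <= / (2 * s) * / w).
  { unfold h; assert (Hsp : s <= sin (x / 2)) by (apply Hsu; lra).
    assert (0 < 2 * w * s) by nra.
    assert (2 * w * s <= 2 * w * sin (x / 2)) by nra.
    rewrite Rabs_mult, (Rabs_pos_eq (/ _)) by (apply Rlt_le, Rinv_0_lt_compat; lra).
    replace (/ (2 * s) * / w) with (1 * / (2 * w * s)) by (field; lra).
    apply Rmult_le_compat; [apply Rabs_pos | apply Rlt_le, Rinv_0_lt_compat; lra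
      | apply Rabs_le, COS_bound | apply Rinv_le_contravar; assumption]. }
  replace (sin_sum N x - (PI - x) / 2) with (E x - h x) by (unfold E; ring).
  eapply Rle_trans; [apply Rabs_triang|]; rewrite Rabs_Ropp.
  rewrite Rmult_plus_distr_r; apply Rplus_le_compat; [|exact Hh].
  eapply Rle_trans; [exact HE|].
  replace (PI / (4 * s ^ 2) * / w) with (/ (4 * w * s ^ 2) * PI) by (field; lra).
  apply Rmult_le_compat_l; [|lra].
  apply Rlt_le, Rinv_0_lt_compat, Rmult_lt_0_compat; [lra | nra].
Qed.

(** The previous bound, taken with [x0 = x], is uniform on [x, PI], so it can be integrated there.
    It degenerates as [x] tends to 0, which leaves the point 0 to a separate argument. *)
Lemma cos_sum_bound (N : nat) (x : R) :
  0 < x <= PI ->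
  Rabs (cos_sum N x - cos_sum N PI - (PI - x) ^ 2 / 4)
    <= (PI / (4 * sin (x / 2) ^ 2) + / (2 * sin (x / 2))) * / (INR N + / 2) * (PI - x).
Proof.
  intros Hx.
  set (P := fun u => cos_sum N u - (PI - u) ^ 2 / 4).
  replace (cos_sum N x - cos_sum N PI - (PI - x) ^ 2 / 4) with (- (P PI - P x))
    by (unfold P; field).
  rewrite Rabs_Ropp.
  apply MVT_abs_le with (df := fun u => - (sin_sum N u - (PI - u) / 2)); [lra | |].
  - intros u Hu; unfold P.
    replace (- (sin_sum N u - (PI - u) / 2)) with (- sin_sum N u - (- (PI - u) / 2)) by field.
    apply (is_derive_minus (cos_sum N)); [apply is_derive_cos_sum|].
    auto_derive; [trivial | field].
  - intros u Hu; rewrite Rabs_Ropp; apply sin_sum_bound; lra.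
Qed.

Lemma cos_term_bound (x : R) (j : nat) : Rabs (cos (INR j * x) * / INR j ^ 2) <= / INR j ^ 2.
Proof.
  assert (0 <= / INR j ^ 2).
  { destruct j; [simpl; rewrite Rmult_0_l, Rinv_0; lra|].
    apply Rlt_le, Rinv_0_lt_compat, pow_lt, lt_0_INR; lia. }
  rewrite Rabs_mult, (Rabs_pos_eq (/ _)) by assumption.
  rewrite <- (Rmult_1_l (/ INR j ^ 2)) at 2.
  apply Rmult_le_compat_r; [assumption | apply Rabs_le, COS_bound].
Qed.

Lemma cos_sum_lim (x : R) : is_lim_seq (fun N => cos_sum N x) (cos_series x).
Proof.
  apply Series_sum, ex_series_dominated with (fun j => / INR j ^ 2);
    [apply cos_term_bound | apply ex_series_inv_sqr].
Qed.

Lemma is_lim_seq_inv_INR_half : is_lim_seq (fun N => / (INR N + / 2)) 0.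
Proof.
  replace (Finite 0) with (Rbar_inv p_infty) by reflexivity.
  apply is_lim_seq_inv; [|discriminate].
  eapply is_lim_seq_plus; [apply is_lim_seq_INR | apply is_lim_seq_const | reflexivity].
Qed.

(** The constant [cos_series PI] may stay unevaluated: the Green's function involves only a
    difference of two values of [cos_series]. *)
Lemma cos_series_pos (x : R) :
  0 < x <= PI -> cos_series x = cos_series PI + (PI - x) ^ 2 / 4.
Proof.
  intros Hx.
  set (k := (PI / (4 * sin (x / 2) ^ 2) + / (2 * sin (x / 2)))).
  assert (L : is_lim_seq (fun N => cos_sum N x - cos_sum N PI - (PI - x) ^ 2 / 4) 0).
  { apply is_lim_seq_abs_0.
    apply is_lim_seq_le_le with (fun _ => 0) (fun N => k * / (INR N + / 2) * (PI - x)).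
    - intros N; split; [apply Rabs_pos | apply cos_sum_bound, Hx].
    - apply is_lim_seq_const.
    - replace (Finite 0) with (Finite (k * 0 * (PI - x))) by (f_equal; ring).
      apply is_lim_seq_mult'; [|apply is_lim_seq_const].
      apply is_lim_seq_mult'; [apply is_lim_seq_const | apply is_lim_seq_inv_INR_half]. }
  assert (L' : is_lim_seq (fun N => cos_sum N x - cos_sum N PI - (PI - x) ^ 2 / 4)
      (cos_series x - cos_series PI - (PI - x) ^ 2 / 4)).
  { apply is_lim_seq_minus'; [|apply is_lim_seq_const].
    apply is_lim_seq_minus'; apply cos_sum_lim. }
  apply is_lim_seq_unique in L; apply is_lim_seq_unique in L'.
  rewrite L in L'; injection L'; lra.
Qed.

(** Uniform convergence gives continuity at 0: [N] is fixed first so that the tail is small at every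
    point, and then a small [x > 0], where the formula is known, is compared with 0. *)
Lemma cos_series_0 : cos_series 0 = cos_series PI + PI ^ 2 / 4.
Proof.
  apply cond_eq; intros eps He.
  pose proof PI_RGT_0 as HPI.
  destruct (tail_lt (fun j => / INR j ^ 2) (eps / 8) ex_series_inv_sqr) as [N HN]; [lra|].
  assert (HT : forall x, Rabs (cos_series x - cos_sum N x) < eps / 8).
  { intros x; eapply Rle_lt_trans; [|exact HN].
    apply Series_tail_dominated; [apply cos_term_bound | apply ex_series_inv_sqr]. }
  assert (Hc : continuous (fun x => cos_sum N x - (PI - x) ^ 2 / 4) 0).
  { apply (ex_derive_continuous (fun x => cos_sum N x - (PI - x) ^ 2 / 4)).
    apply (ex_derive_minus (cos_sum N)); [eexists; apply is_derive_cos_sum | auto_derive; trivial]. }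
  assert (He8 : 0 < eps / 8) by lra.
  destruct (proj1 (filterlim_locally _ _) Hc (mkposreal _ He8)) as [d Hd].
  set (x := Rmin (d / 2) 1).
  assert (Hx : 0 < x /\ x < d /\ x <= 1).
  { unfold x; pose proof (cond_pos d); pose proof (Rmin_l (d / 2) 1); pose proof (Rmin_r (d / 2) 1).
    repeat split; try lra; apply Rmin_glb_lt; lra. }
  assert (Hb : ball 0 d x).
  { unfold ball; simpl; unfold AbsRing_ball, abs, minus, plus, opp; simpl.
    rewrite Rabs_pos_eq; lra. }
  specialize (Hd x Hb); unfold ball in Hd; simpl in Hd;
    unfold AbsRing_ball, abs, minus, plus, opp in Hd; simpl in Hd.
  pose proof (HT 0) as H0; pose proof (HT x) as H1.
  assert (H2 : cos_series x = cos_series PI + (PI - x) ^ 2 / 4)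
    by (apply cos_series_pos; pose proof PI2_1; lra).
  apply Rabs_def2 in Hd; apply Rabs_def2 in H0; apply Rabs_def2 in H1.
  apply Rabs_def1; lra.
Qed.

(** The range reaches [2 * PI] because the Green's function uses the argument [x + t]; the second
    half follows from the symmetry of the cosines about [PI]. *)
Lemma cos_series_parabola (x : R) :
  0 <= x <= 2 * PI -> cos_series x = cos_series PI + (PI - x) ^ 2 / 4.
Proof.
  intros Hx.
  assert (H : forall u, 0 <= u <= PI -> cos_series u = cos_series PI + (PI - u) ^ 2 / 4).
  { intros u Hu; destruct (Req_dec u 0) as [-> | Hu0].
    - rewrite cos_series_0; field.
    - apply cos_series_pos; lra. }
  destruct (Rle_lt_dec x PI) as [H1 | H1]; [apply H; lra|].
  replace (cos_series x) with (cos_series (2 * PI - x)).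
  - rewrite H by lra; field.
  - apply Series_ext; intros j; f_equal.
    replace (INR j * (2 * PI - x)) with (- (INR j * x) + 2 * INR j * PI) by ring.
    rewrite cos_period; apply cos_neg.
Qed.

(** * The Green's function of the Dirichlet problem *)

(** The Green's function of [- y''] on [0, PI] with Dirichlet conditions. *)
Definition green (x t : R) : R := if Rle_dec t x then t * (PI - x) / PI else x * (PI - t) / PI.

(** The product-to-sum formula turns the partial sums into those of [cos_series] at |x - t| minus
    those at x + t. The two parabolas differ by a difference of squares, which factors into [green]
    times [PI]. This plays the role of completeness of the sine system. *)
Lemma green_series (x t : R) :
  0 <= x <= PI -> 0 <= t <= PI ->
  is_series (fun j => 2 / PI * (sin (INR j * x) * sin (INR j * t) * / INR j ^ 2)) (green x t).
Proof.
  intros Hx Ht; pose proof PI_RGT_0 as HPI.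
  apply is_series_sum.
  apply is_lim_seq_ext with (fun N => / PI * (cos_sum N (Rabs (x - t)) - cos_sum N (x + t))).
  { intros N; rewrite sum_scal; unfold cos_sum; rewrite <- sum_minus.
    unfold Rdiv; rewrite (Rmult_comm 2), Rmult_assoc; f_equal.
    rewrite <- sum_scal; apply sum_eq; intros j _.
    replace (cos (INR j * Rabs (x - t))) with (cos (INR j * (x - t))).
    - rewrite Rmult_minus_distr_l, Rmult_plus_distr_l, cos_minus, cos_plus; ring.
    - unfold Rabs; destruct (Rcase_abs (x - t)); [|reflexivity].
      rewrite <- cos_neg; f_equal; ring. }
  replace (green x t) with (/ PI * (cos_series (Rabs (x - t)) - cos_series (x + t))).
  - apply is_lim_seq_mult'; [apply is_lim_seq_const|].
    apply is_lim_seq_minus'; apply cos_sum_lim.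
  - rewrite (cos_series_parabola (Rabs (x - t))), (cos_series_parabola (x + t)); [|lra|].
    + unfold green, Rabs; destruct (Rcase_abs (x - t)), (Rle_dec t x); try lra; field; lra.
    + split; [apply Rabs_pos | apply Rabs_le; lra].
Qed.

(** * Sine coefficients of the solutions *)

Lemma cont_mult (f g : R -> R) (x : R) :
  continuous f x -> continuous g x -> continuous (fun t => f t * g t) x.
Proof. apply (continuous_mult f g). Qed.

Lemma cont_plus (f g : R -> R) (x : R) :
  continuous f x -> continuous g x -> continuous (fun t => f t + g t) x.
Proof. apply (continuous_plus f g). Qed.

Lemma cont_minus (f g : R -> R) (x : R) :
  continuous f x -> continuous g x -> continuous (fun t => f t - g t) x.
Proof. apply (continuous_minus f g). Qed.

Lemma cont_const (k x : R) : continuous (fun _ : R => k) x.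
Proof. apply continuous_const. Qed.

Lemma cont_id (x : R) : continuous (fun t : R => t) x.
Proof. apply continuous_id. Qed.

Lemma cont_sin (k x : R) : continuous (fun t => sin (k * t)) x.
Proof. apply (ex_derive_continuous (fun t => sin (k * t))); auto_derive; trivial. Qed.

Lemma cont_cos (k x : R) : continuous (fun t => cos (k * t)) x.
Proof. apply (ex_derive_continuous (fun t => cos (k * t))); auto_derive; trivial. Qed.

Ltac cont :=
  repeat (first [ assumption | apply cont_const ] ||
    lazymatch goal with
    | |- continuous (fun t => t) _ => apply cont_id
    | |- continuous (fun t => sin (_ * t)) _ => apply cont_sin
    | |- continuous (fun t => cos (_ * t)) _ => apply cont_cos
    | |- continuous (fun t => _ * _) _ => apply cont_mult
    | |- continuous (fun t => _ + _) _ => apply cont_plus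
    | |- continuous (fun t => _ - _) _ => apply cont_minus
    | |- continuous (Rminus ?k) _ => apply (cont_minus (fun _ => k) (fun t => t))
    end).

Lemma RInt_mult_l (f : R -> R) (k u v : R) :
  ex_RInt f u v -> RInt (fun t => k * f t) u v = k * RInt f u v.
Proof. intros H; apply (RInt_scal f u v k H). Qed.

Lemma RInt_add (f g : R -> R) (u v : R) :
  ex_RInt f u v -> ex_RInt g u v ->
  RInt (fun t => f t + g t) u v = RInt f u v + RInt g u v.
Proof. intros Hf Hg; apply (RInt_plus f g u v Hf Hg). Qed.

Lemma RInt_sub (f g : R -> R) (u v : R) :
  ex_RInt f u v -> ex_RInt g u v ->
  RInt (fun t => f t - g t) u v = RInt f u v - RInt g u v.
Proof. intros Hf Hg; apply (RInt_minus f g u v Hf Hg). Qed.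

Lemma ex_RInt_add (f g : R -> R) (u v : R) :
  ex_RInt f u v -> ex_RInt g u v -> ex_RInt (fun t => f t + g t) u v.
Proof. intros Hf Hg; apply (ex_RInt_plus f g u v Hf Hg). Qed.

Lemma ex_RInt_sub (f g : R -> R) (u v : R) :
  ex_RInt f u v -> ex_RInt g u v -> ex_RInt (fun t => f t - g t) u v.
Proof. intros Hf Hg; apply (ex_RInt_minus f g u v Hf Hg). Qed.

Lemma ex_RInt_mult_l (f : R -> R) (k u v : R) :
  ex_RInt f u v -> ex_RInt (fun t => k * f t) u v.
Proof. intros H; apply (ex_RInt_scal f u v k H). Qed.

Lemma ex_RInt_cont (f : R -> R) :
  (forall x, 0 <= x <= PI -> continuous f x) -> ex_RInt f 0 PI.
Proof.
  intros H; apply (@ex_RInt_continuous R_CompleteNormedModule).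
  pose proof PI_RGT_0; rewrite Rmin_left, Rmax_right by lra; exact H.
Qed.

Lemma RInt_ext_0_PI (f g : R -> R) :
  (forall x, 0 < x < PI -> f x = g x) -> RInt f 0 PI = RInt g 0 PI.
Proof.
  intros H; apply RInt_ext; pose proof PI_RGT_0.
  rewrite Rmin_left, Rmax_right by lra; exact H.
Qed.

Lemma ex_RInt_ext_0_PI (f g : R -> R) :
  (forall x, 0 < x < PI -> f x = g x) -> ex_RInt f 0 PI -> ex_RInt g 0 PI.
Proof.
  intros H; apply ex_RInt_ext; pose proof PI_RGT_0.
  rewrite Rmin_left, Rmax_right by lra; exact H.
Qed.

Lemma ex_RInt_sum (u : nat -> R -> R) (N : nat) :
  (forall j, ex_RInt (u j) 0 PI) ->
  ex_RInt (fun t => sum_f_R0 (fun j => u j t) N) 0 PI.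
Proof.
  intros H; induction N as [|N IH]; [apply H|].
  apply (ex_RInt_add (fun t => sum_f_R0 (fun j => u j t) N)); [exact IH | apply H].
Qed.

Lemma RInt_sum (u : nat -> R -> R) (N : nat) :
  (forall j, ex_RInt (u j) 0 PI) ->
  RInt (fun t => sum_f_R0 (fun j => u j t) N) 0 PI = sum_f_R0 (fun j => RInt (u j) 0 PI) N.
Proof.
  intros H; induction N as [|N IH]; [reflexivity|].
  cbn [sum_f_R0]; rewrite <- IH.
  apply (RInt_add (fun t => sum_f_R0 (fun j => u j t) N)); [apply ex_RInt_sum, H | apply H].
Qed.

(** The majorant makes the convergence uniform. Only integrability is asked of the terms and of the
    limit, because the integrands to come contain the discontinuous [q]. *)
Lemma RInt_series (u : nat -> R -> R) (psi : R -> R) (v : nat -> R) :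
  (forall j, ex_RInt (u j) 0 PI) -> ex_RInt psi 0 PI ->
  (forall j t, 0 <= t <= PI -> Rabs (u j t) <= v j) -> ex_series v ->
  (forall t, 0 <= t <= PI -> is_series (fun j => u j t) (psi t)) ->
  is_series (fun j => RInt (u j) 0 PI) (RInt psi 0 PI).
Proof.
  intros Hu Hpsi Hb Hv Hs; pose proof PI_RGT_0 as HPI.
  apply is_series_sum.
  apply is_lim_seq_ext with
    (fun N => RInt psi 0 PI - RInt (fun t => psi t - sum_f_R0 (fun j => u j t) N) 0 PI).
  { intros N.
    rewrite RInt_sub; [| exact Hpsi | apply ex_RInt_sum, Hu].
    rewrite RInt_sum by exact Hu; ring. }
  replace (Finite (RInt psi 0 PI)) with (Finite (RInt psi 0 PI - 0)) by (f_equal; ring).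
  apply is_lim_seq_minus'; [apply is_lim_seq_const|].
  apply is_lim_seq_abs_0.
  apply is_lim_seq_le_le with (fun _ => 0) (fun N => (PI - 0) * (Series v - sum_f_R0 v N)).
  - intros N; split; [apply Rabs_pos|].
    apply abs_RInt_le_const; [lra | |].
    + apply ex_RInt_sub; [exact Hpsi | apply ex_RInt_sum, Hu].
    + intros t Ht; rewrite <- (is_series_unique _ _ (Hs t Ht)).
      apply Series_tail_dominated; [intros j; apply Hb, Ht | exact Hv].
  - apply is_lim_seq_const.
  - replace (Finite 0) with (Finite ((PI - 0) * 0)) by (f_equal; ring).
    apply is_lim_seq_mult'; [apply is_lim_seq_const | apply tail_to_0, Hv].
Qed.

(** Normalised so that these are the coefficients of the sine series itself. Index 0 is kept, with
    value 0, so that all sequences start at 0. *)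
Definition scoef (f : R -> R) (j : nat) : R :=
  2 / PI * RInt (fun x => f x * sin (INR j * x)) 0 PI.

Lemma scoef_0 (f : R -> R) : scoef f 0 = 0.
Proof.
  unfold scoef.
  rewrite (RInt_ext_0_PI _ (fun _ => 0)) by (intros; simpl; rewrite Rmult_0_l, sin_0; ring).
  rewrite RInt_const; unfold scal; simpl; unfold mult; simpl; ring.
Qed.

Lemma RInt_cos_Z (k : Z) :
  RInt (fun x => cos (IZR k * x)) 0 PI = if Z.eq_dec k 0 then PI else 0.
Proof.
  destruct (Z.eq_dec k 0) as [-> | Hk].
  - rewrite (RInt_ext_0_PI _ (fun _ => 1)) by (intros; rewrite Rmult_0_l; apply cos_0).
    rewrite RInt_const; unfold scal; simpl; unfold mult; simpl; ring.
  - assert (Hk' : IZR k <> 0) by now apply not_0_IZR.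
    apply is_RInt_unique.
    replace 0 with (sin (IZR k * PI) * / IZR k - sin (IZR k * 0) * / IZR k) at 2.
    + apply (is_RInt_derive (fun x => sin (IZR k * x) * / IZR k) (fun x => cos (IZR k * x))).
      * intros x _; auto_derive; [trivial | field; assumption].
      * intros x _; apply cont_cos.
    + rewrite Rmult_0_r, sin_0, sin_eq_0_1; [ring | now exists k].
Qed.

Lemma scoef_sin (n m : nat) :
  (1 <= n)%nat -> scoef (fun x => sin (INR n * x)) m = if Nat.eq_dec m n then 1 else 0.
Proof.
  intros Hn; unfold scoef; pose proof PI_RGT_0 as HPI.
  rewrite (RInt_ext_0_PI _ (fun x => / 2 * cos (IZR (Z.of_nat n - Z.of_nat m) * x)
      + - / 2 * cos (IZR (Z.of_nat n + Z.of_nat m) * x))).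
  2:{ intros x _; rewrite plus_IZR, minus_IZR, <- !INR_IZR_INZ.
      rewrite Rmult_minus_distr_r, Rmult_plus_distr_r, cos_minus, cos_plus; field. }
  rewrite RInt_add by (apply ex_RInt_cont; intros; cont).
  rewrite !RInt_mult_l by (apply ex_RInt_cont; intros; cont).
  rewrite !RInt_cos_Z.
  destruct (Z.eq_dec (Z.of_nat n + Z.of_nat m) 0); [lia|].
  destruct (Z.eq_dec (Z.of_nat n - Z.of_nat m) 0), (Nat.eq_dec m n); try lia; field; lra.
Qed.

Definition smatrix (a b c : R) (m j : nat) : R :=
  scoef (fun x => q a b c x * sin (INR j * x)) m.

(** One notion covers eigenfunctions ([tau = 0]) and the test problem ([tau = 1]). The boundary
    conditions are kept apart because solutions built from initial data at 0 need not vanish at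
    [PI]. *)
Definition is_solution (a b c lam tau : R) (n : nat) (y y' : R -> R) : Prop :=
  (forall x, 0 <= x <= PI -> is_derive y x (y' x)) /\
  continuous y' c /\
  (forall x, 0 <= x <= PI -> x <> c ->
     is_derive y' x ((q a b c x - lam) * y x - tau * sin (INR n * x))).

Lemma q_bound (a b c x : R) : Rabs (q a b c x) <= Rabs a + Rabs b.
Proof.
  pose proof (Rabs_pos a); pose proof (Rabs_pos b).
  unfold q; destruct (Rle_dec x c); lra.
Qed.

Lemma Rabs_mult_sin (k x : R) : Rabs (k * sin x) <= Rabs k.
Proof.
  assert (Rabs k * Rabs (sin x) <= Rabs k * 1)
    by (apply Rmult_le_compat_l; [apply Rabs_pos | apply Rabs_le, SIN_bound]).
  rewrite Rabs_mult; lra.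
Qed.

Lemma sum_step_integrable (a b c : R) (f1 f2 : R -> R) :
  0 < c < PI ->
  (forall x, 0 <= x <= PI -> continuous f1 x) ->
  (forall x, 0 <= x <= PI -> continuous f2 x) ->
  ex_RInt (fun x => q a b c x * f1 x + f2 x) 0 PI.
Proof.
  intros Hc H1 H2; apply ex_RInt_add; [now apply ex_RInt_step | now apply ex_RInt_cont].
Qed.

Lemma scoef_bound (f : R -> R) (B : R) (j : nat) :
  ex_RInt (fun x => f x * sin (INR j * x)) 0 PI ->
  (forall x, 0 <= x <= PI -> Rabs (f x) <= B) ->
  Rabs (scoef f j) <= 2 * B.
Proof.
  intros Hf HB; unfold scoef; pose proof PI_RGT_0 as HPI.
  assert (Rabs (RInt (fun x => f x * sin (INR j * x)) 0 PI) <= (PI - 0) * B).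
  { apply abs_RInt_le_const; [lra | exact Hf|].
    intros t Ht; eapply Rle_trans; [apply Rabs_mult_sin | apply HB, Ht]. }
  rewrite Rabs_mult, (Rabs_pos_eq (2 / PI)) by (apply Rlt_le, Rdiv_lt_0_compat; lra).
  replace (2 * B) with (2 / PI * ((PI - 0) * B)) by (field; lra).
  apply Rmult_le_compat_l; [apply Rlt_le, Rdiv_lt_0_compat; lra | assumption].
Qed.

Section Solution.
Variables (a b c lam tau : R) (n : nat) (y y' : R -> R).
Hypothesis Hc : 0 < c < PI.
Hypothesis Hsol : is_solution a b c lam tau n y y'.
Hypothesis Hy0 : y 0 = 0.
Hypothesis HyPI : y PI = 0.

(** [g] is [y''] away from [c], and [rest] is its continuous part; the splitting is the one that
    [FTC_step] expects. *)
Let rest (x : R) : R := - lam * y x - tau * sin (INR n * x).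
Let g (x : R) : R := q a b c x * y x + rest x.

Local Lemma y_cont x : 0 <= x <= PI -> continuous y x.
Proof.
  intros Hx; apply (ex_derive_continuous y); eexists; apply (proj1 Hsol), Hx.
Qed.

Local Lemma y'_cont x : 0 <= x <= PI -> continuous y' x.
Proof.
  intros Hx; destruct (Req_dec x c) as [-> | Hxc]; [apply (proj1 (proj2 Hsol))|].
  apply (ex_derive_continuous y'); eexists; apply (proj2 (proj2 Hsol)); assumption.
Qed.

Local Lemma rest_cont x : 0 <= x <= PI -> continuous rest x.
Proof. intros Hx; pose proof (y_cont x Hx); unfold rest; cont. Qed.

Local Lemma y'_derive x : 0 <= x <= PI -> x <> c -> is_derive y' x (g x).
Proof.
  intros Hx Hxc; replace (g x) with ((q a b c x - lam) * y x - tau * sin (INR n * x))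
    by (unfold g, rest; ring).
  apply (proj2 (proj2 Hsol)); assumption.
Qed.

Local Lemma g_integrable (f : R -> R) :
  (forall x, 0 <= x <= PI -> continuous f x) -> ex_RInt (fun x => g x * f x) 0 PI.
Proof.
  intros Hf.
  apply ex_RInt_ext_0_PI with (fun x => q a b c x * (y x * f x) + rest x * f x).
  - intros x _; unfold g; ring.
  - apply sum_step_integrable; [exact Hc | |]; intros x Hx;
      pose proof (y_cont x Hx); pose proof (rest_cont x Hx); pose proof (Hf x Hx); cont.
Qed.

Local Lemma g_bounded : exists B, forall x, 0 <= x <= PI -> Rabs (g x) <= B.
Proof.
  destruct (bounded_continuity y 0 PI) as [B1 H1]; [exact y_cont|].
  destruct (bounded_continuity rest 0 PI) as [B2 H2]; [exact rest_cont|].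
  exists ((Rabs a + Rabs b) * B1 + B2); intros x Hx.
  specialize (H1 x Hx); specialize (H2 x Hx); unfold norm in H1, H2; simpl in H1, H2;
    unfold abs in H1, H2; simpl in H1, H2.
  unfold g; eapply Rle_trans; [apply Rabs_triang|]; apply Rplus_le_compat; [|lra].
  rewrite Rabs_mult; apply Rmult_le_compat; try apply Rabs_pos; [apply q_bound | lra].
Qed.

(** Two integrations by parts at once: [F] is the Wronskian-type bracket of [y] and sin jx, with
    derivative (y'' + j^2 y) sin jx, and it vanishes at both ends. *)
Local Lemma scoef_by_parts (j : nat) : INR j ^ 2 * scoef y j = - scoef g j.
Proof.
  pose proof PI_RGT_0 as HPI.
  set (F := fun x => y' x * sin (INR j * x) - INR j * (y x * cos (INR j * x))).
  set (f1 := fun x => y x * sin (INR j * x)).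
  set (f2 := fun x => rest x * sin (INR j * x) + INR j ^ 2 * (y x * sin (INR j * x))).
  assert (HI : is_RInt (fun x => q a b c x * f1 x + f2 x) 0 PI (F PI - F 0)).
  { apply FTC_step; try lra.
    1-3: intros x Hx; pose proof (y_cont x Hx); pose proof (y'_cont x Hx);
      pose proof (rest_cont x Hx); unfold F, f1, f2; cont.
    intros x Hx Hxc.
    replace (q a b c x * f1 x + f2 x)
      with ((g x * sin (INR j * x) + y' x * (INR j * cos (INR j * x)))
         - INR j * (y' x * cos (INR j * x) + y x * (- INR j * sin (INR j * x))))
      by (unfold f1, f2, g; ring).
    apply (is_derive_minus (fun x => y' x * sin (INR j * x))).
    - apply (is_derive_mult y' (fun x => sin (INR j * x))); [apply y'_derive; lra | auto_derive; [trivial|ring]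
        | intros; apply Rmult_comm].
    - apply (is_derive_scal (fun x => y x * cos (INR j * x))).
      apply (is_derive_mult y (fun x => cos (INR j * x))); [apply (proj1 Hsol); lra | auto_derive; [trivial|ring]
        | intros; apply Rmult_comm]. }
  apply (@is_RInt_unique R_CompleteNormedModule) in HI.
  unfold F in HI; rewrite sin_nat_PI, Hy0, HyPI, !Rmult_0_r, sin_0 in HI.
  assert (HS : RInt (fun x => q a b c x * f1 x + f2 x) 0 PI
      = RInt (fun x => g x * sin (INR j * x)) 0 PI
        + INR j ^ 2 * RInt (fun x => y x * sin (INR j * x)) 0 PI).
  { assert (ex_RInt (fun x => y x * sin (INR j * x)) 0 PI).
    { apply ex_RInt_cont; intros x Hx; pose proof (y_cont x Hx); cont. }
    rewrite <- RInt_mult_l by assumption.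
    rewrite <- RInt_add; [| apply g_integrable; intros; cont | apply ex_RInt_mult_l; assumption].
    apply RInt_ext_0_PI; intros x _; unfold f1, f2, g; ring. }
  rewrite HI in HS; unfold scoef; nra.
Qed.

Local Lemma scoef_eq (j : nat) : scoef y j = - / INR j ^ 2 * scoef g j.
Proof.
  destruct j as [|j]; [rewrite !scoef_0; ring|].
  assert (INR (S j) <> 0) by (apply not_0_INR; discriminate).
  replace (scoef g (S j)) with (- (INR (S j) ^ 2 * scoef y (S j)))
    by (rewrite scoef_by_parts; ring).
  field; assumption.
Qed.

(** Boundedness of [y''] suffices, despite its jump. The resulting absolute summability justifies
    every later exchange of sums and integrals. *)
Lemma scoef_decay : exists K, forall j, Rabs (scoef y j) <= K * / INR j ^ 2.
Proof.
  destruct g_bounded as [B HB]; exists (2 * B); intros j.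
  rewrite scoef_eq, Rabs_mult, Rabs_Ropp, Rmult_comm.
  apply Rmult_le_compat; try apply Rabs_pos.
  - apply scoef_bound; [apply g_integrable; intros; cont | exact HB].
  - destruct j; [simpl; rewrite Rmult_0_l, Rinv_0, Rabs_R0; lra|].
    rewrite Rabs_pos_eq; [lra|].
    apply Rlt_le, Rinv_0_lt_compat, pow_lt, lt_0_INR; lia.
Qed.

Local Lemma green_representation (x : R) :
  0 <= x <= PI -> is_RInt (fun t => green x t * g t) 0 PI (- y x).
Proof.
  intros Hx; pose proof PI_RGT_0 as HPI.
  (* [F1] and [F2] are antiderivatives of [green x t * y''(t)] for t below and above [x]. At [t = x]
     the terms in [y'] cancel and the mismatch is [- y x]; at 0 and [PI] only boundary values of [y]
     remain. *)
  set (F1 := fun t => (PI - x) / PI * (t * y' t - y t)).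
  set (F2 := fun t => x / PI * ((PI - t) * y' t + y t)).
  replace (- y x) with ((F1 x - F1 0) + (F2 PI - F2 x))
    by (unfold F1, F2; rewrite Hy0, HyPI; field; lra).
  apply (@is_RInt_Chasles R_NormedModule) with x.
  - apply is_RInt_ext_le with (fun t => q a b c t * ((PI - x) / PI * (t * y t))
      + (PI - x) / PI * (t * rest t)); [lra | |].
    + intros t Ht.
      unfold green, g; destruct (Rle_dec t x); [field; lra | lra].
    + apply FTC_step; [lra | | | |];
        try (intros t Ht; assert (Ht' : 0 <= t <= PI) by lra; pose proof (y_cont t Ht');
          pose proof (y'_cont t Ht'); pose proof (rest_cont t Ht'); unfold F1; cont; fail).
      intros t Ht Htc.
      replace (q a b c t * ((PI - x) / PI * (t * y t)) + (PI - x) / PI * (t * rest t))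
        with ((PI - x) / PI * ((1 * y' t + t * g t) - y' t)) by (unfold g; ring).
      apply (is_derive_scal (fun t => t * y' t - y t)).
      apply (is_derive_minus (fun t => t * y' t)); [|apply (proj1 Hsol); lra].
      apply (is_derive_mult (fun t => t) y'); [apply (is_derive_id (K := R_AbsRing))
        | apply y'_derive; lra | intros; apply Rmult_comm].
  - apply is_RInt_ext_le with (fun t => q a b c t * (x / PI * ((PI - t) * y t))
      + x / PI * ((PI - t) * rest t)); [lra | |].
    + intros t Ht.
      unfold green, g; destruct (Rle_dec t x); [lra | field; lra].
    + apply FTC_step; [lra | | | |];
        try (intros t Ht; assert (Ht' : 0 <= t <= PI) by lra; pose proof (y_cont t Ht');
          pose proof (y'_cont t Ht'); pose proof (rest_cont t Ht'); unfold F2; cont; fail).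
      intros t Ht Htc.
      replace (q a b c t * (x / PI * ((PI - t) * y t)) + x / PI * ((PI - t) * rest t))
        with (x / PI * ((-1 * y' t + (PI - t) * g t) + y' t)) by (unfold g; ring).
      apply (is_derive_scal (fun t => (PI - t) * y' t + y t)).
      apply (is_derive_plus (fun t => (PI - t) * y' t)); [|apply (proj1 Hsol); lra].
      apply (is_derive_mult (fun t => PI - t) y'); [auto_derive; [trivial|ring]
        | apply y'_derive; lra | intros; apply Rmult_comm].
Qed.

(** The series of [green x t] is integrated termwise against [y''] in the Green representation. Each
    term then contains the sine coefficient of [y''] divided by j^2, which is the coefficient of [y]
    up to sign. *)
Lemma sine_expansion (x : R) :
  0 <= x <= PI -> is_series (fun j => scoef y j * sin (INR j * x)) (y x).
Proof.
  intros Hx; pose proof PI_RGT_0 as HPI.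
  destruct g_bounded as [B HB].
  assert (H : is_series (fun j => RInt (fun t =>
      2 / PI * (sin (INR j * x) * sin (INR j * t) * / INR j ^ 2) * g t) 0 PI)
      (RInt (fun t => green x t * g t) 0 PI)).
  { apply RInt_series with (fun j => 2 / PI * B * / INR j ^ 2).
    - intros j; apply ex_RInt_ext_0_PI with
        (fun t => g t * (2 / PI * (sin (INR j * x) * sin (INR j * t) * / INR j ^ 2))).
      + intros; ring.
      + apply g_integrable; intros; cont.
    - eexists; apply green_representation, Hx.
    - intros j t Ht.
      assert (0 <= / INR j ^ 2).
      { eapply Rle_trans; [apply Rabs_pos | apply (cos_term_bound 0)]. }
      replace (2 / PI * (sin (INR j * x) * sin (INR j * t) * / INR j ^ 2) * g t)
        with (2 / PI * / INR j ^ 2 * (g t * sin (INR j * x) * sin (INR j * t))) by ring.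
      replace (2 / PI * B * / INR j ^ 2) with (2 / PI * / INR j ^ 2 * B) by ring.
      assert (0 <= 2 / PI * / INR j ^ 2)
        by (apply Rmult_le_pos; [apply Rlt_le, Rdiv_lt_0_compat; lra | assumption]).
      rewrite Rabs_mult, (Rabs_pos_eq (_ * / _)) by assumption.
      apply Rmult_le_compat_l; [assumption|].
      do 2 (eapply Rle_trans; [apply Rabs_mult_sin|]); apply HB, Ht.
    - apply (ex_series_scal (2 / PI * B) (fun j => / INR j ^ 2)), ex_series_inv_sqr.
    - intros t Ht.
      apply (is_series_ext (fun j => g t *
        (2 / PI * (sin (INR j * x) * sin (INR j * t) * / INR j ^ 2)))).
      + intros j; cbn; ring.
      + rewrite Rmult_comm; apply is_series_mult_l, green_series; assumption. }
  rewrite (@is_RInt_unique R_CompleteNormedModule _ _ _ _ (green_representation x Hx)) in H.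
  apply (is_series_mult_l _ (-1)) in H.
  replace (-1 * - y x) with (y x) in H by ring.
  revert H; apply is_series_ext; intros j.
  rewrite scoef_eq; unfold scoef.
  rewrite (RInt_ext_0_PI _ (fun t => (2 / PI * (sin (INR j * x) * / INR j ^ 2))
    * (g t * sin (INR j * t)))) by (intros; ring).
  rewrite RInt_mult_l by (apply g_integrable; intros; cont).
  cbn; ring.
Qed.

(** The sine expansion of [y] is multiplied by q(t) sin mt and integrated termwise, with the
    majorant supplied by [scoef_decay]. *)
Lemma smatrix_expansion (m : nat) :
  is_series (fun j => smatrix a b c m j * scoef y j) (scoef (fun x => q a b c x * y x) m).
Proof.
  destruct scoef_decay as [K HK].
  assert (H : is_series (fun j => RInt (fun t =>
      scoef y j * (q a b c t * sin (INR j * t) * sin (INR m * t))) 0 PI)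
      (RInt (fun t => q a b c t * y t * sin (INR m * t)) 0 PI)).
  { apply RInt_series with (fun j => (Rabs a + Rabs b) * K * / INR j ^ 2).
    - intros j; apply ex_RInt_mult_l.
      apply ex_RInt_ext_0_PI with (fun t => q a b c t * (sin (INR j * t) * sin (INR m * t)));
        [intros; ring|].
      apply ex_RInt_step; [exact Hc | intros; cont].
    - apply ex_RInt_ext_0_PI with (fun t => q a b c t * (y t * sin (INR m * t)));
        [intros; ring|].
      apply ex_RInt_step; [exact Hc | intros x Hx; pose proof (y_cont x Hx); cont].
    - intros j t Ht.
      replace (scoef y j * (q a b c t * sin (INR j * t) * sin (INR m * t)))
        with (q a b c t * scoef y j * sin (INR j * t) * sin (INR m * t)) by ring.
      do 2 (eapply Rle_trans; [apply Rabs_mult_sin|]).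
      rewrite Rabs_mult, Rmult_assoc.
      apply Rmult_le_compat; try apply Rabs_pos; [apply q_bound | apply HK].
    - apply (ex_series_scal ((Rabs a + Rabs b) * K) (fun j => / INR j ^ 2)), ex_series_inv_sqr.
    - intros t Ht.
      apply (is_series_ext (fun j => q a b c t * sin (INR m * t)
        * (scoef y j * sin (INR j * t)))).
      + intros j; cbn; ring.
      + replace (q a b c t * y t * sin (INR m * t)) with (q a b c t * sin (INR m * t) * y t)
          by ring.
        apply is_series_mult_l, sine_expansion, Ht. }
  apply (is_series_mult_l _ (2 / PI)) in H.
  revert H; apply is_series_ext; intros j.
  rewrite RInt_mult_l; [unfold smatrix, scoef; cbn; ring|].
  apply ex_RInt_ext_0_PI with (fun t => q a b c t * (sin (INR j * t) * sin (INR m * t)));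
    [intros; ring|].
  apply ex_RInt_step; [exact Hc | intros; cont].
Qed.

Lemma mode_equation (m : nat) :
  (1 <= n)%nat ->
  (lam - INR m ^ 2) * scoef y m
    = scoef (fun x => q a b c x * y x) m - tau * (if Nat.eq_dec m n then 1 else 0).
Proof.
  intros Hn; rewrite Rmult_minus_distr_r, scoef_by_parts, <- (scoef_sin n m Hn).
  unfold scoef.
  assert (Hyi : ex_RInt (fun x => y x * sin (INR m * x)) 0 PI)
    by (apply ex_RInt_cont; intros x Hx; pose proof (y_cont x Hx); cont).
  assert (Hsi : ex_RInt (fun x => sin (INR n * x) * sin (INR m * x)) 0 PI)
    by (apply ex_RInt_cont; intros x Hx; cont).
  assert (Hqi : ex_RInt (fun x => q a b c x * y x * sin (INR m * x)) 0 PI).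
  { apply ex_RInt_ext_0_PI with (fun t => q a b c t * (y t * sin (INR m * t)));
      [intros; ring|].
    apply ex_RInt_step; [exact Hc | intros x Hx; pose proof (y_cont x Hx); cont]. }
  rewrite (RInt_ext_0_PI (fun x => g x * sin (INR m * x))
    (fun x => q a b c x * y x * sin (INR m * x)
      + (- lam * (y x * sin (INR m * x)) + - tau * (sin (INR n * x) * sin (INR m * x)))))
    by (intros; unfold g, rest; ring).
  rewrite RInt_add; [| exact Hqi | apply ex_RInt_add; apply ex_RInt_mult_l; assumption].
  rewrite RInt_add by (apply ex_RInt_mult_l; assumption).
  rewrite !RInt_mult_l by assumption; ring.
Qed.

End Solution.

(** * The multiplication operator on sequences of sine coefficients *)

Definition sine_poly (v : nat -> R) (J : nat) (x : R) : R :=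
  sum_f_R0 (fun j => v j * sin (INR j * x)) J.

Lemma sine_poly_cont (v : nat -> R) (J : nat) (x : R) : continuous (sine_poly v J) x.
Proof.
  unfold sine_poly; induction J as [|J IH]; [cbn [sum_f_R0]; cont|].
  apply (cont_plus (sine_poly v J)); [exact IH | cont].
Qed.

(** Orthogonality of the sines. Equality may fail only through index 0, which counts on the right
    although its sine vanishes. *)
Lemma sine_poly_energy (v : nat -> R) (J : nat) :
  2 / PI * RInt (fun x => sine_poly v J x ^ 2) 0 PI <= sum_f_R0 (fun j => v j ^ 2) J.
Proof.
  induction J as [|J IH].
  - rewrite (RInt_ext_0_PI _ (fun _ => 0)).
    + rewrite RInt_const; unfold scal; simpl; unfold mult; simpl; nra.
    + intros x _; unfold sine_poly; simpl; rewrite Rmult_0_l, sin_0; ring.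
  - set (s := fun x => sin (INR (S J) * x)).
    assert (Hs : forall x, continuous s x) by (intros; apply cont_sin).
    assert (Hp := sine_poly_cont v J).
    rewrite (RInt_ext_0_PI _ (fun x => sine_poly v J x ^ 2
      + (2 * v (S J) * (sine_poly v J x * s x) + v (S J) ^ 2 * (s x * s x)))).
    2:{ intros x _; unfold sine_poly, s; cbn [sum_f_R0]; ring. }
    assert (H1 : ex_RInt (fun x => sine_poly v J x ^ 2) 0 PI).
    { apply ex_RInt_ext_0_PI with (fun x => sine_poly v J x * sine_poly v J x);
        [intros; ring|]; apply ex_RInt_cont; intros; apply cont_mult; apply Hp. }
    assert (H2 : ex_RInt (fun x => sine_poly v J x * s x) 0 PI)
      by (apply ex_RInt_cont; intros; apply cont_mult; [apply Hp | apply Hs]).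
    assert (H3 : ex_RInt (fun x => s x * s x) 0 PI)
      by (apply ex_RInt_cont; intros; apply cont_mult; apply Hs).
    rewrite RInt_add; [|exact H1 | apply ex_RInt_add; apply ex_RInt_mult_l; assumption].
    rewrite RInt_add by (apply ex_RInt_mult_l; assumption).
    rewrite !RInt_mult_l by assumption.
    assert (E3 : 2 / PI * RInt (fun x => s x * s x) 0 PI = 1).
    { assert (E := scoef_sin (S J) (S J)).
      destruct (Nat.eq_dec (S J) (S J)); [apply E; lia | lia]. }
    assert (E2 : RInt (fun x => sine_poly v J x * s x) 0 PI = 0).
    { rewrite (RInt_ext_0_PI _ (fun x => sum_f_R0 (fun j => v j * (s x * sin (INR j * x))) J)).
      - rewrite (RInt_sum (fun j x => v j * (s x * sin (INR j * x)))).
        + rewrite (sum_eq _ (fun _ => 0)); [rewrite sum_cte; apply Rmult_0_l|].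
          intros j Hj; rewrite RInt_mult_l by (apply ex_RInt_cont; intros; unfold s; cont).
          assert (E := scoef_sin (S J) j ltac:(lia)); unfold scoef in E.
          destruct (Nat.eq_dec j (S J)); [lia|].
          pose proof PI_RGT_0; fold s in E.
          apply Rmult_integral in E; destruct E as [E | E].
          * assert (0 < 2 / PI) by (apply Rdiv_lt_0_compat; lra); lra.
          * change (RInt (fun x => s x * sin (INR j * x)) 0 PI = 0) in E; rewrite E; ring.
        + intros j; apply ex_RInt_cont; intros; unfold s; cont.
      - intros x _; unfold sine_poly; rewrite Rmult_comm, <- sum_scal.
        apply sum_eq; intros; ring. }
    cbn [sum_f_R0]; rewrite E2.
    replace (2 / PI * (RInt (fun x => sine_poly v J x ^ 2) 0 PI
        + (2 * v (S J) * 0 + v (S J) ^ 2 * RInt (fun x => s x * s x) 0 PI)))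
      with (2 / PI * RInt (fun x => sine_poly v J x ^ 2) 0 PI
        + v (S J) ^ 2 * (2 / PI * RInt (fun x => s x * s x) 0 PI)) by ring.
    rewrite E3; lra.
Qed.

Lemma is_lim_seq_sum (u : nat -> nat -> R) (l : nat -> R) (J : nat) :
  (forall m, is_lim_seq (u m) (l m)) ->
  is_lim_seq (fun N => sum_f_R0 (fun m => u m N) J) (sum_f_R0 l J).
Proof.
  intros H; induction J as [|J IH]; [apply H|].
  apply (is_lim_seq_plus' (fun N => sum_f_R0 (fun m => u m N) J)); [exact IH | apply H].
Qed.

Lemma sum_indicator (u : nat -> R) (m : nat) :
  sum_f_R0 (fun i => u i * (if Nat.eq_dec i m then 1 else 0)) m = u m.
Proof.
  assert (H : forall J, (J < m)%nat ->
      sum_f_R0 (fun i => u i * (if Nat.eq_dec i m then 1 else 0)) J = 0).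
  { induction J as [|J IH]; intros HJ; cbn [sum_f_R0].
    - destruct (Nat.eq_dec 0 m); [lia | ring].
    - rewrite IH by lia; destruct (Nat.eq_dec (S J) m); [lia | ring]. }
  destruct m as [|m]; cbn [sum_f_R0].
  - destruct (Nat.eq_dec 0 0); [ring | lia].
  - rewrite H by lia; destruct (Nat.eq_dec (S m) (S m)); [ring | lia].
Qed.

Lemma sum_sqr_le (v : nat -> R) (J : nat) :
  sum_f_R0 (fun j => v j ^ 2) J <= sum_f_R0 (fun j => Rabs (v j)) J ^ 2.
Proof.
  assert (Hp : forall J, 0 <= sum_f_R0 (fun j => Rabs (v j)) J)
    by (intros; apply cond_pos_sum; intros; apply Rabs_pos).
  induction J as [|J IH]; cbn [sum_f_R0].
  - rewrite pow2_abs; lra.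
  - rewrite <- (pow2_abs (v (S J))); specialize (Hp J); pose proof (Rabs_pos (v (S J))); nra.
Qed.

Definition summable (v : nat -> R) : Prop := ex_series (fun j => Rabs (v j)).

(** An l^2 bound phrased through partial sums, so that no infinite sum of squares has to be handled.
    [summable] guarantees that the series exist, while the contraction is measured by this bound. *)
Definition energy_le (v : nat -> R) (be : R) : Prop :=
  forall J, sum_f_R0 (fun j => v j ^ 2) J <= be ^ 2.

Lemma summable_energy (v : nat -> R) : summable v -> exists be, 0 < be /\ energy_le v be.
Proof.
  (* The [+ 1] keeps the bound strictly positive, since its inverse will serve as a weight. *)
  intros H; exists (Series (fun j => Rabs (v j)) + 1).
  assert (Hs : forall J, sum_f_R0 (fun j => Rabs (v j)) J <= Series (fun j => Rabs (v j)))
    by (intros; apply sum_le_Series; [intros; apply Rabs_pos | exact H]).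
  assert (Hp : forall J, 0 <= sum_f_R0 (fun j => Rabs (v j)) J)
    by (intros; apply cond_pos_sum; intros; apply Rabs_pos).
  split.
  - specialize (Hs 0%nat); specialize (Hp 0%nat); lra.
  - intros J; eapply Rle_trans; [apply sum_sqr_le|].
    specialize (Hs J); specialize (Hp J); nra.
Qed.

Section Operator.
Variables (a b c M : R).
Hypothesis Hc : 0 < c < PI.
Hypothesis HM : 0 < M.
Hypothesis Hq : forall x, Rabs (q a b c x) <= M.

Local Lemma smatrix_integrable (m j : nat) :
  ex_RInt (fun x => q a b c x * sin (INR j * x) * sin (INR m * x)) 0 PI.
Proof.
  apply ex_RInt_ext_0_PI with (fun t => q a b c t * (sin (INR j * t) * sin (INR m * t)));
    [intros; ring|].
  apply ex_RInt_step; [exact Hc | intros; cont].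
Qed.

Lemma smatrix_bound (m j : nat) : Rabs (smatrix a b c m j) <= 2 * M.
Proof.
  apply scoef_bound; [apply smatrix_integrable|].
  intros x _; eapply Rle_trans; [apply Rabs_mult_sin | apply Hq].
Qed.

(** Writing the truncated matrix form as an integral is what allows the pointwise bound of [q] by M
    to be used; entrywise bounds of the matrix would not give the operator norm. *)
Local Lemma form_integral (v r : nat -> R) (J' J : nat) :
  sum_f_R0 (fun m => sum_f_R0 (fun j => smatrix a b c m j * v j) J' * r m) J
  = 2 / PI * RInt (fun x => q a b c x * (sine_poly v J' x * sine_poly r J x)) 0 PI.
Proof.
  assert (HI : forall m j, ex_RInt (fun x =>
      v j * (q a b c x * sin (INR j * x) * sin (INR m * x))) 0 PI)
    by (intros; apply ex_RInt_mult_l, smatrix_integrable).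
  assert (HS : forall m, ex_RInt (fun x => r m * sum_f_R0 (fun j =>
      v j * (q a b c x * sin (INR j * x) * sin (INR m * x))) J') 0 PI)
    by (intros; apply ex_RInt_mult_l; apply (ex_RInt_sum (fun j x =>
      v j * (q a b c x * sin (INR j * x) * sin (INR m * x)))); intros; apply HI).
  rewrite (RInt_ext_0_PI _ (fun x => sum_f_R0 (fun m => r m * sum_f_R0 (fun j =>
      v j * (q a b c x * sin (INR j * x) * sin (INR m * x))) J') J)).
  - rewrite (RInt_sum (fun m x => r m * sum_f_R0 (fun j =>
      v j * (q a b c x * sin (INR j * x) * sin (INR m * x))) J')) by exact HS.
    rewrite <- sum_scal; apply sum_eq; intros m _.
    rewrite RInt_mult_l by (apply (ex_RInt_sum (fun j x =>
      v j * (q a b c x * sin (INR j * x) * sin (INR m * x)))); intros; apply HI).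
    rewrite (RInt_sum (fun j x => v j * (q a b c x * sin (INR j * x) * sin (INR m * x))))
      by (intros; apply HI).
    rewrite <- Rmult_assoc, (Rmult_comm (2 / PI)), Rmult_assoc, Rmult_comm; f_equal.
    rewrite <- sum_scal; apply sum_eq; intros j _.
    rewrite RInt_mult_l by apply smatrix_integrable.
    unfold smatrix, scoef; ring.
  - intros x _; unfold sine_poly.
    rewrite <- Rmult_assoc, <- sum_scal; apply sum_eq; intros m _.
    replace (q a b c x * sum_f_R0 (fun j => v j * sin (INR j * x)) J' * (r m * sin (INR m * x)))
      with (r m * (q a b c x * sin (INR m * x) * sum_f_R0 (fun j => v j * sin (INR j * x)) J'))
      by ring.
    f_equal; rewrite <- sum_scal; apply sum_eq; intros; ring.
Qed.

(* Pointwise [|q V W| <= M (al V^2 + W^2 / al) / 2] avoids the Cauchy-Schwarz inequality. *)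
Lemma form_bound (v r : nat -> R) (J' J : nat) (al : R) :
  0 < al ->
  Rabs (sum_f_R0 (fun m => sum_f_R0 (fun j => smatrix a b c m j * v j) J' * r m) J)
  <= M / 2 * (al * sum_f_R0 (fun j => v j ^ 2) J' + / al * sum_f_R0 (fun j => r j ^ 2) J).
Proof.
  intros Hal; pose proof PI_RGT_0 as HPI.
  assert (Hal' : 0 < / al) by now apply Rinv_0_lt_compat.
  rewrite form_integral.
  set (V := sine_poly v J'); set (W := sine_poly r J).
  assert (HV : forall x, continuous V x) by apply sine_poly_cont.
  assert (HW : forall x, continuous W x) by apply sine_poly_cont.
  assert (HV2 : ex_RInt (fun x => V x ^ 2) 0 PI).
  { apply ex_RInt_ext_0_PI with (fun x => V x * V x); [intros; ring|].
    apply ex_RInt_cont; intros; apply cont_mult; apply HV. }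
  assert (HW2 : ex_RInt (fun x => W x ^ 2) 0 PI).
  { apply ex_RInt_ext_0_PI with (fun x => W x * W x); [intros; ring|].
    apply ex_RInt_cont; intros; apply cont_mult; apply HW. }
  set (bnd := fun x => M / 2 * (al * V x ^ 2 + / al * W x ^ 2)).
  assert (Hsum : ex_RInt (fun x => al * V x ^ 2 + / al * W x ^ 2) 0 PI)
    by (apply ex_RInt_add; apply ex_RInt_mult_l; assumption).
  assert (Hbnd : ex_RInt bnd 0 PI) by (apply ex_RInt_mult_l, Hsum).
  assert (HqVW : ex_RInt (fun x => q a b c x * (V x * W x)) 0 PI).
  { apply ex_RInt_step; [exact Hc | intros; apply cont_mult; [apply HV | apply HW]]. }
  assert (Hpt : forall x, Rabs (q a b c x * (V x * W x)) <= bnd x).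
  { intros x; unfold bnd; rewrite Rabs_mult.
    apply Rle_trans with (M * Rabs (V x * W x)).
    - apply Rmult_le_compat_r; [apply Rabs_pos | apply Hq].
    - replace (M / 2 * (al * V x ^ 2 + / al * W x ^ 2))
        with (M * ((al * V x ^ 2 + / al * W x ^ 2) / 2)) by (field; lra).
      apply Rmult_le_compat_l; [lra|].
      assert (H1 : 0 <= / al * (al * V x - W x) ^ 2)
        by (apply Rmult_le_pos; [lra | apply pow2_ge_0]).
      assert (H2 : 0 <= / al * (al * V x + W x) ^ 2)
        by (apply Rmult_le_pos; [lra | apply pow2_ge_0]).
      assert (E1 : / al * (al * V x - W x) ^ 2
        = al * V x ^ 2 - 2 * (V x * W x) + / al * W x ^ 2) by (field; lra).
      assert (E2 : / al * (al * V x + W x) ^ 2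
        = al * V x ^ 2 + 2 * (V x * W x) + / al * W x ^ 2) by (field; lra).
      rewrite E1 in H1; rewrite E2 in H2.
      apply Rabs_le; lra. }
  assert (HR : Rabs (RInt (fun x => q a b c x * (V x * W x)) 0 PI) <= RInt bnd 0 PI).
  { apply Rabs_le; split.
    - replace (- RInt bnd 0 PI) with (RInt (fun x => -1 * bnd x) 0 PI)
        by (rewrite RInt_mult_l by exact Hbnd; cbn; ring).
      apply RInt_le; [lra | apply ex_RInt_mult_l, Hbnd | exact HqVW|].
      intros x _; specialize (Hpt x); apply Rabs_le_between in Hpt; lra.
    - apply RInt_le; [lra | exact HqVW | exact Hbnd|].
      intros x _; specialize (Hpt x); apply Rabs_le_between in Hpt; lra. }
  assert (H2PI : 0 < 2 / PI) by (apply Rdiv_lt_0_compat; lra).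
  rewrite Rabs_mult, (Rabs_pos_eq (2 / PI)) by lra.
  apply Rle_trans with (2 / PI * RInt bnd 0 PI); [apply Rmult_le_compat_l; lra|].
  unfold bnd; rewrite RInt_mult_l by exact Hsum.
  rewrite RInt_add by (apply ex_RInt_mult_l; assumption).
  rewrite !RInt_mult_l by assumption.
  replace (2 / PI * (M / 2 * (al * RInt (fun x => V x ^ 2) 0 PI + / al * RInt (fun x => W x ^ 2) 0 PI)))
    with (M / 2 * (al * (2 / PI * RInt (fun x => V x ^ 2) 0 PI)
      + / al * (2 / PI * RInt (fun x => W x ^ 2) 0 PI))) by ring.
  apply Rmult_le_compat_l; [lra|].
  apply Rplus_le_compat; apply Rmult_le_compat_l; try lra; apply sine_poly_energy.
Qed.

Definition apply_q (v : nat -> R) (m : nat) : R := Series (fun j => smatrix a b c m j * v j).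

Local Lemma apply_q_dominated (v : nat -> R) (m j : nat) :
  Rabs (smatrix a b c m j * v j) <= 2 * M * Rabs (v j).
Proof.
  rewrite Rabs_mult; apply Rmult_le_compat_r; [apply Rabs_pos | apply smatrix_bound].
Qed.

Lemma apply_q_ex (v : nat -> R) (m : nat) :
  summable v -> ex_series (fun j => smatrix a b c m j * v j).
Proof.
  intros H; apply ex_series_dominated with (fun j => 2 * M * Rabs (v j)).
  - apply apply_q_dominated.
  - apply (ex_series_scal (2 * M) (fun j => Rabs (v j))), H.
Qed.

Lemma apply_q_sup (v : nat -> R) (m : nat) :
  summable v -> Rabs (apply_q v m) <= 2 * M * Series (fun j => Rabs (v j)).
Proof.
  intros H.
  assert (Hd : ex_series (fun j => Rabs (smatrix a b c m j * v j))).
  { apply ex_series_dominated with (fun j => 2 * M * Rabs (v j)).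
    - intros j; rewrite Rabs_Rabsolu; apply apply_q_dominated.
    - apply (ex_series_scal (2 * M) (fun j => Rabs (v j))), H. }
  eapply Rle_trans; [apply Series_Rabs, Hd|].
  rewrite <- Series_scal_l; apply Series_le.
  - intros j; split; [apply Rabs_pos | apply apply_q_dominated].
  - apply (ex_series_scal (2 * M) (fun j => Rabs (v j))), H.
Qed.

Lemma apply_q_linear (u v : nat -> R) (k : R) (m : nat) :
  summable u -> summable v ->
  apply_q (fun j => u j + k * v j) m = apply_q u m + k * apply_q v m.
Proof.
  intros Hu Hv; unfold apply_q.
  rewrite <- Series_scal_l, <- Series_plus.
  - apply Series_ext; intros; ring.
  - apply apply_q_ex, Hu.
  - apply (ex_series_scal k (fun j => smatrix a b c m j * v j)), apply_q_ex, Hv.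
Qed.

(** The inner sum is completed by a limit, while the test sequence [r] stays truncated. The weight
    [al] is left free because its two uses below balance different quantities. *)
Lemma apply_q_form_bound (v r : nat -> R) (J : nat) (al be : R) :
  0 < al -> summable v -> energy_le v be ->
  sum_f_R0 (fun m => apply_q v m * r m) J
  <= M / 2 * (al * be ^ 2 + / al * sum_f_R0 (fun j => r j ^ 2) J).
Proof.
  intros Hal Hv Hbe.
  assert (L : is_lim_seq (fun J' =>
      sum_f_R0 (fun m => sum_f_R0 (fun j => smatrix a b c m j * v j) J' * r m) J)
      (sum_f_R0 (fun m => apply_q v m * r m) J)).
  { apply (is_lim_seq_sum (fun m J' => sum_f_R0 (fun j => smatrix a b c m j * v j) J' * r m)).
    intros m; apply is_lim_seq_mult'; [|apply is_lim_seq_const].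
    apply Series_sum, apply_q_ex, Hv. }
  refine (is_lim_seq_le _ (fun _ => M / 2 * (al * be ^ 2 + / al * sum_f_R0 (fun j => r j ^ 2) J))
    _ _ _ L (is_lim_seq_const _)).
  intros J'; eapply Rle_trans; [apply Rle_abs|].
  eapply Rle_trans; [apply form_bound, Hal|].
  apply Rmult_le_compat_l; [lra|]; apply Rplus_le_compat_r, Rmult_le_compat_l; [lra | apply Hbe].
Qed.

Lemma apply_q_bound (v : nat -> R) (m : nat) (be : R) :
  0 < be -> summable v -> energy_le v be -> Rabs (apply_q v m) <= M * be.
Proof.
  intros Hbe Hv He.
  assert (H : forall sg, sg ^ 2 = 1 -> sg * apply_q v m <= M * be).
  { intros sg Hsg.
    (* The test sequence is plus or minus the unit vector at [m]. The weight [/ be] makes both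
       halves of the bound equal to [M / 2 * be]. *)
    assert (B := apply_q_form_bound v (fun i => sg * (if Nat.eq_dec i m then 1 else 0)) m (/ be) be
      (Rinv_0_lt_compat _ Hbe) Hv He).
    rewrite (sum_eq _ (fun i => sg * apply_q v i * (if Nat.eq_dec i m then 1 else 0))) in B
      by (intros; ring).
    rewrite (sum_indicator (fun i => sg * apply_q v i)) in B.
    rewrite (sum_eq _ (fun i => 1 * (if Nat.eq_dec i m then 1 else 0))) in B
      by (intros; rewrite Rpow_mult_distr, Hsg; destruct (Nat.eq_dec i m); ring).
    rewrite (sum_indicator (fun _ => 1)) in B.
    eapply Rle_trans; [exact B|]; apply Req_le; field; lra. }
  assert (H1 := H 1 ltac:(ring)); assert (H2 := H (-1) ltac:(ring)).
  apply Rabs_le; lra.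
Qed.

Variables (dd : nat -> R) (de : R).
Hypothesis Hde : 0 < de.
Hypothesis Hdd : forall j, Rabs (dd j) <= de.
Hypothesis Hdd_sum : summable dd.

Definition reduced (v : nat -> R) (m : nat) : R := dd m * apply_q v m.

Lemma reduced_summable (v : nat -> R) : summable v -> summable (reduced v).
Proof.
  intros Hv.
  apply ex_series_dominated with (fun j => 2 * M * Series (fun j => Rabs (v j)) * Rabs (dd j)).
  - intros j; rewrite Rabs_Rabsolu; unfold reduced; rewrite Rabs_mult, Rmult_comm.
    apply Rmult_le_compat_r; [apply Rabs_pos | apply apply_q_sup, Hv].
  - apply (ex_series_scal _ (fun j => Rabs (dd j))), Hdd_sum.
Qed.

(** A duality argument: testing the form against [dd m * u m], where [u] is the image of [v],
    produces the energy of [u] on the left. The weight [M * de ^ 2] makes that energy reappear on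
    the right with coefficient 1/2, where it is absorbed. *)
Lemma reduced_energy (v : nat -> R) (be : R) :
  summable v -> energy_le v be -> energy_le (reduced v) (M * de * be).
Proof.
  intros Hv He J.
  set (u := reduced v).
  assert (Hal : 0 < M * de ^ 2) by (apply Rmult_lt_0_compat; [lra | nra]).
  assert (B := apply_q_form_bound v (fun m => dd m * u m) J (M * de ^ 2) be Hal Hv He).
  rewrite (sum_eq _ (fun m => u m ^ 2)) in B by (intros; unfold u, reduced; ring).
  assert (H : sum_f_R0 (fun j => (dd j * u j) ^ 2) J <= de ^ 2 * sum_f_R0 (fun m => u m ^ 2) J).
  { rewrite <- sum_scal; apply sum_Rle; intros j _.
    rewrite Rpow_mult_distr; apply Rmult_le_compat_r; [apply pow2_ge_0|].
    rewrite <- (pow2_abs (dd j)); apply pow_incr; split; [apply Rabs_pos | apply Hdd]. }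
  set (X := sum_f_R0 (fun m => u m ^ 2) J) in *.
  assert (H' : / (M * de ^ 2) * sum_f_R0 (fun j => (dd j * u j) ^ 2) J <= / M * X).
  { replace (/ M * X) with (/ (M * de ^ 2) * (de ^ 2 * X)) by (field; lra).
    apply Rmult_le_compat_l; [apply Rlt_le, Rinv_0_lt_compat, Hal | exact H]. }
  assert (B' : X <= M / 2 * (M * de ^ 2 * be ^ 2 + / M * X)).
  { eapply Rle_trans; [exact B|]; apply Rmult_le_compat_l; [lra|].
    apply Rplus_le_compat_l, H'. }
  replace (M / 2 * (M * de ^ 2 * be ^ 2 + / M * X)) with ((M * de * be) ^ 2 / 2 + X / 2) in B'
    by (field; lra).
  lra.
Qed.

Lemma iter_reduced (v : nat -> R) (be : R) (K : nat) :
  summable v -> energy_le v be ->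
  summable (Nat.iter K reduced v) /\ energy_le (Nat.iter K reduced v) ((M * de) ^ K * be).
Proof.
  intros Hv He; induction K as [|K [IH1 IH2]].
  - split; [exact Hv|]; simpl; rewrite Rmult_1_l; exact He.
  - split; [apply reduced_summable, IH1|].
    replace ((M * de) ^ S K * be) with (M * de * ((M * de) ^ K * be)) by (simpl; ring).
    apply reduced_energy; assumption.
Qed.

End Operator.

(** * The Fourier coefficients of the potential *)

Lemma Ccoef_integrable (a b c : R) (k : Z) :
  0 < c < PI -> ex_RInt (fun x => q a b c x * cos (IZR k * x)) 0 PI.
Proof. intros Hc; apply ex_RInt_step; [exact Hc | intros; cont]. Qed.

Lemma Ccoef_even (a b c : R) (k : Z) : Ccoef a b c (- k) = Ccoef a b c k.
Proof.
  unfold Ccoef; f_equal; apply RInt_ext_0_PI; intros x _.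
  rewrite opp_IZR, Ropp_mult_distr_l_reverse, cos_neg; reflexivity.
Qed.

Lemma Ccoef_0 (a b c : R) : 0 < c < PI -> a * c + b * (PI - c) = 0 -> Ccoef a b c 0 = 0.
Proof.
  intros Hc H; unfold Ccoef.
  rewrite (RInt_ext_0_PI _ (fun x => q a b c x * 1))
    by (intros; rewrite Rmult_0_l, cos_0; reflexivity).
  rewrite (is_RInt_unique _ _ _ _ (is_RInt_step a b c PI (fun _ => 1) Hc (fun x _ => cont_const 1 x))).
  rewrite !RInt_const; unfold scal; simpl; unfold mult; simpl.
  replace (a * ((c - 0) * 1) + b * ((PI - c) * 1)) with (a * c + b * (PI - c)) by ring.
  rewrite H; ring.
Qed.

Lemma Ccoef_bound (a b c M : R) (k : Z) :
  0 < c < PI -> (forall x, Rabs (q a b c x) <= M) -> Rabs (Ccoef a b c k) <= M.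
Proof.
  intros Hc Hq; unfold Ccoef; pose proof PI_RGT_0 as HPI.
  assert (H : Rabs (RInt (fun x => q a b c x * cos (IZR k * x)) 0 PI) <= (PI - 0) * M).
  { apply abs_RInt_le_const; [lra | now apply Ccoef_integrable|].
    intros t _; rewrite Rabs_mult, <- (Rmult_1_r M).
    apply Rmult_le_compat; try apply Rabs_pos; [apply Hq | apply Rabs_le, COS_bound]. }
  assert (Hi : 0 < / PI) by now apply Rinv_0_lt_compat.
  rewrite Rabs_mult, (Rabs_pos_eq (/ PI)) by lra.
  apply Rle_trans with (/ PI * ((PI - 0) * M)); [apply Rmult_le_compat_l; lra|].
  apply Req_le; field; lra.
Qed.

Lemma RInt_cos_scaled (k u v : R) :
  k <> 0 -> RInt (fun x => cos (k * x)) u v = sin (k * v) * / k - sin (k * u) * / k.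
Proof.
  intros Hk; apply is_RInt_unique.
  apply (is_RInt_derive (fun x => sin (k * x) * / k) (fun x => cos (k * x))).
  - intros x _; auto_derive; [trivial | field; assumption].
  - intros x _; apply cont_cos.
Qed.

(** Read off from C_k = (a - b) sin(kc) / (pi k). The form with a threshold [N] is the one needed
    for steps that leave the box. *)
Lemma Ccoef_decay (a b c : R) (k : Z) (N : nat) :
  0 < c < PI -> (Z.of_nat N < Z.abs k)%Z ->
  Rabs (Ccoef a b c k) <= (Rabs a + Rabs b) * / (INR N + 1).
Proof.
  intros Hc Hk; pose proof PI_RGT_0 as HPI; pose proof (pos_INR N) as HN.
  assert (Hk0 : IZR k <> 0) by (apply not_0_IZR; lia).
  assert (Hka : INR N + 1 <= Rabs (IZR k)).
  { rewrite <- abs_IZR, INR_IZR_INZ, <- plus_IZR; apply IZR_le; lia. }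
  assert (E : Ccoef a b c k = (a - b) * sin (IZR k * c) * / (PI * IZR k)).
  { unfold Ccoef.
    rewrite (is_RInt_unique _ _ _ _
      (is_RInt_step a b c PI (fun x => cos (IZR k * x)) Hc (fun x _ => cont_cos _ x))).
    rewrite !RInt_cos_scaled by assumption.
    rewrite Rmult_0_r, sin_0, (sin_eq_0_1 (IZR k * PI)) by now exists k.
    field; split; [assumption | lra]. }
  rewrite E, Rabs_mult.
  apply Rmult_le_compat; try apply Rabs_pos.
  - eapply Rle_trans; [apply Rabs_mult_sin|].
    eapply Rle_trans; [apply Rabs_triang | rewrite Rabs_Ropp; lra].
  - rewrite Rabs_inv, Rabs_mult, (Rabs_pos_eq PI) by lra.
    apply Rinv_le_contravar; [lra|].
    pose proof PI2_1; nra.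
Qed.

(** By the product-to-sum formula. The difference of two C's in the numerator of a_k is thus a
    matrix entry between a position and mode n. *)
Lemma smatrix_Ccoef (a b c : R) (m j : nat) :
  0 < c < PI ->
  smatrix a b c m j
    = Ccoef a b c (Z.of_nat j - Z.of_nat m) - Ccoef a b c (Z.of_nat j + Z.of_nat m).
Proof.
  intros Hc; unfold smatrix, scoef, Ccoef; pose proof PI_RGT_0 as HPI.
  rewrite <- Rmult_minus_distr_l.
  rewrite <- RInt_sub by now apply Ccoef_integrable.
  rewrite (RInt_ext_0_PI (fun x => q a b c x * cos _ - _)
    (fun x => 2 * (q a b c x * sin (INR j * x) * sin (INR m * x)))).
  - rewrite RInt_mult_l; [field; lra|].
    apply ex_RInt_ext_0_PI with (fun t => q a b c t * (sin (INR j * t) * sin (INR m * t)));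
      [intros; ring|].
    apply ex_RInt_step; [exact Hc | intros; cont].
  - intros x _; rewrite plus_IZR, minus_IZR, <- !INR_IZR_INZ.
    rewrite Rmult_minus_distr_r, Rmult_plus_distr_r, cos_minus, cos_plus; ring.
Qed.

(** * Sums over integer intervals and boxes *)

Fixpoint isum (f : Z -> R) (lo : Z) (len : nat) : R :=
  match len with
  | O => 0
  | S l => f lo + isum f (lo + 1)%Z l
  end.

Definition lsum {T : Type} (l : list T) (f : T -> R) : R := fold_right Rplus 0 (map f l).

Lemma lsum_app {T : Type} (l1 l2 : list T) (f : T -> R) :
  lsum (l1 ++ l2) f = lsum l1 f + lsum l2 f.
Proof.
  induction l1 as [|x l1 IH].
  - change (lsum l2 f = 0 + lsum l2 f); ring.
  - change (f x + lsum (l1 ++ l2) f = f x + lsum l1 f + lsum l2 f); rewrite IH; ring.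
Qed.

Lemma lsum_scal {T : Type} (l : list T) (f : T -> R) (k : R) :
  lsum l (fun x => k * f x) = k * lsum l f.
Proof.
  induction l as [|x l IH]; [cbn; ring|].
  change (k * f x + lsum l (fun x => k * f x) = k * (f x + lsum l f)); rewrite IH; ring.
Qed.

Lemma lsum_zrange (N : nat) (f : Z -> R) :
  lsum (zrange N) f = isum f (- Z.of_nat N) (2 * N + 1).
Proof.
  assert (H : forall len s, lsum (map (fun i => (Z.of_nat i - Z.of_nat N)%Z) (seq s len)) f
      = isum f (Z.of_nat s - Z.of_nat N) len).
  { induction len as [|len IH]; intros s; [reflexivity|].
    cbn; f_equal; unfold lsum in IH; rewrite IH; f_equal; lia. }
  apply (H _ 0%nat).
Qed.

Lemma isum_shift (f : Z -> R) (p : Z) (len : nat) (lo : Z) :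
  isum (fun x => f (p + x)%Z) lo len = isum f (p + lo) len.
Proof.
  revert lo; induction len as [|len IH]; intros lo; cbn; [reflexivity|].
  rewrite IH; do 2 f_equal; lia.
Qed.

Lemma isum_app (f : Z -> R) (l1 l2 : nat) (lo : Z) :
  isum f lo (l1 + l2) = isum f lo l1 + isum f (lo + Z.of_nat l1) l2.
Proof.
  revert lo; induction l1 as [|l1 IH]; intros lo; cbn [isum Nat.add].
  - rewrite Rplus_0_l; f_equal; lia.
  - rewrite IH, Rplus_assoc; do 3 f_equal; lia.
Qed.

Lemma isum_minus (f g : Z -> R) (len : nat) (lo : Z) :
  isum (fun x => f x - g x) lo len = isum f lo len - isum g lo len.
Proof.
  revert lo; induction len as [|len IH]; intros lo; cbn; [ring|]; rewrite IH; ring.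
Qed.

Lemma isum_scal (f : Z -> R) (k : R) (len : nat) (lo : Z) :
  isum (fun x => k * f x) lo len = k * isum f lo len.
Proof.
  revert lo; induction len as [|len IH]; intros lo; cbn; [ring|]; rewrite IH; ring.
Qed.

Lemma isum_dominated (f w : Z -> R) (len : nat) (lo : Z) :
  (forall x, (lo <= x < lo + Z.of_nat len)%Z -> Rabs (f x) <= w x) ->
  Rabs (isum f lo len) <= isum w lo len.
Proof.
  revert lo; induction len as [|len IH]; intros lo H; cbn.
  - rewrite Rabs_R0; lra.
  - eapply Rle_trans; [apply Rabs_triang|]; apply Rplus_le_compat.
    + apply H; lia.
    + apply IH; intros x Hx; apply H; lia.
Qed.

Lemma isum_pos (w : Z -> R) (len : nat) (lo : Z) :
  (forall x, 0 <= w x) -> 0 <= isum w lo len.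
Proof.
  intros H; revert lo; induction len as [|len IH]; intros lo; cbn; [lra|].
  specialize (H lo); specialize (IH (lo + 1)%Z); lra.
Qed.

(** The window lies inside [-J, J], so the difference consists of the terms on its two sides.
    Majorising by the sum of [w] over the whole interval gives a bound independent of the window. *)
Lemma isum_compare (f w : Z -> R) (lo : Z) (len J : nat) :
  (forall x, 0 <= w x) ->
  (forall x, (x < lo \/ lo + Z.of_nat len <= x)%Z -> Rabs (f x) <= w x) ->
  (Z.abs lo + Z.of_nat len <= Z.of_nat J)%Z ->
  Rabs (isum f (- Z.of_nat J) (2 * J + 1) - isum f lo len)
    <= isum w (- Z.of_nat J) (2 * J + 1).
Proof.
  intros Hw Hf HJ.
  set (l1 := Z.to_nat (lo + Z.of_nat J)).
  set (l3 := (2 * J + 1 - l1 - len)%nat).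
  assert (H1 : (- Z.of_nat J + Z.of_nat l1 = lo)%Z) by (unfold l1; lia).
  replace (2 * J + 1)%nat with (l1 + (len + l3))%nat by (unfold l3, l1; lia).
  rewrite !isum_app, H1.
  replace (isum f (- Z.of_nat J) l1 + (isum f lo len + isum f (lo + Z.of_nat len) l3)
      - isum f lo len)
    with (isum f (- Z.of_nat J) l1 + isum f (lo + Z.of_nat len) l3) by ring.
  eapply Rle_trans; [apply Rabs_triang|].
  apply Rplus_le_compat.
  - apply isum_dominated; intros x Hx; apply Hf; lia.
  - pose proof (isum_pos w len lo Hw).
    assert (Rabs (isum f (lo + Z.of_nat len) l3) <= isum w (lo + Z.of_nat len) l3).
    { apply isum_dominated; intros x Hx; apply Hf; lia. }
    lra.
Qed.

Lemma isum_sub (w : Z -> R) (lo : Z) (len J : nat) :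
  (forall x, 0 <= w x) ->
  (Z.abs lo + Z.of_nat len <= Z.of_nat J)%Z ->
  isum w lo len <= isum w (- Z.of_nat J) (2 * J + 1).
Proof.
  intros Hw HJ.
  set (l1 := Z.to_nat (lo + Z.of_nat J)).
  set (l3 := (2 * J + 1 - l1 - len)%nat).
  assert (H1 : (- Z.of_nat J + Z.of_nat l1 = lo)%Z) by (unfold l1; lia).
  replace (2 * J + 1)%nat with (l1 + (len + l3))%nat by (unfold l3, l1; lia).
  rewrite !isum_app, H1.
  pose proof (isum_pos w l1 (- Z.of_nat J) Hw).
  pose proof (isum_pos w l3 (lo + Z.of_nat len) Hw); lra.
Qed.

(** Folding j with -j counts 0 twice, hence the subtraction. *)
Lemma isum_symmetric (f : Z -> R) (J : nat) :
  isum f (- Z.of_nat J) (2 * J + 1)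
    = sum_f_R0 (fun j => f (Z.of_nat j) + f (- Z.of_nat j)%Z) J - f 0%Z.
Proof.
  induction J as [|J IH]; [cbn; ring|].
  cbn [sum_f_R0].
  replace (2 * S J + 1)%nat with (S (2 * J + 1 + 1)) by lia.
  cbn [isum].
  replace (- Z.of_nat (S J) + 1)%Z with (- Z.of_nat J)%Z by lia.
  rewrite isum_app, IH; cbn [isum].
  replace (- Z.of_nat J + Z.of_nat (2 * J + 1))%Z with (Z.of_nat (S J)) by lia.
  ring.
Qed.

(** * Tuples of steps as walks on the integers *)

(** [aterm] with its partial sums started at [s] instead of 0. Peeling off the first index of a
    tuple changes only the start, so a recursion on the length becomes available. *)
Definition aterm_from (a b c : R) (n : nat) (lam : R) (s : Z) (l : list Z) : R :=
  let nz := Z.of_nat n in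
  let ps := psums s l in
  if forallb (fun s => andb (negb (Z.eqb s 0)) (negb (Z.eqb s (- 2 * nz)))) ps then
    fold_right Rmult 1 (map (Ccoef a b c) l)
      * (Ccoef a b c (s + zsum l) - Ccoef a b c (s + zsum l + 2 * nz))
      / fold_right Rmult 1 (map (fun s => lam - (IZR (nz + s)) ^ 2) ps)
  else 0.

(** Indexed by the position p = n + s rather than by the partial sum s: the excluded sums 0 and -2n
    become p = n and p = -n, and the exclusion becomes a zero weight. *)
Definition diag (n : nat) (lam : R) (p : Z) : R :=
  if andb (negb (Z.eqb p (Z.of_nat n))) (negb (Z.eqb p (- Z.of_nat n)))
  then / (lam - IZR p ^ 2) else 0.

Lemma diag_even (n : nat) (lam : R) (p : Z) : diag n lam (- p) = diag n lam p.
Proof.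
  unfold diag; rewrite opp_IZR.
  replace ((- IZR p) ^ 2) with (IZR p ^ 2) by ring.
  destruct (Z.eqb_spec (- p) (Z.of_nat n)), (Z.eqb_spec (- p) (- Z.of_nat n)),
    (Z.eqb_spec p (Z.of_nat n)), (Z.eqb_spec p (- Z.of_nat n)); cbn; try lia; reflexivity.
Qed.

Lemma aterm_from_cons (a b c : R) (n : nat) (lam : R) (s x : Z) (l : list Z) :
  aterm_from a b c n lam s (x :: l)
    = Ccoef a b c x * diag n lam (Z.of_nat n + s + x) * aterm_from a b c n lam (s + x) l.
Proof.
  unfold aterm_from, diag.
  cbn [psums forallb map fold_right].
  replace (zsum (x :: l)) with (x + zsum l)%Z by reflexivity.
  rewrite Z.add_assoc.
  replace (Z.eqb (Z.of_nat n + s + x) (Z.of_nat n)) with (Z.eqb (s + x) 0)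
    by (destruct (Z.eqb_spec (s + x) 0), (Z.eqb_spec (Z.of_nat n + s + x) (Z.of_nat n)); lia).
  replace (Z.eqb (Z.of_nat n + s + x) (- Z.of_nat n)) with (Z.eqb (s + x) (- 2 * Z.of_nat n))
    by (destruct (Z.eqb_spec (s + x) (- 2 * Z.of_nat n)),
          (Z.eqb_spec (Z.of_nat n + s + x) (- Z.of_nat n)); lia).
  destruct (negb (Z.eqb (s + x) 0) && negb (Z.eqb (s + x) (- 2 * Z.of_nat n)))%bool;
    cbn [andb]; [|ring].
  destruct (forallb _ (psums (s + x) l)); [|ring].
  unfold Rdiv; rewrite Rinv_mult, Z.add_assoc; ring.
Qed.

Definition box_from (a b c : R) (n : nat) (lam : R) (N k : nat) (p : Z) : R :=
  lsum (tuples N k) (aterm_from a b c n lam (p - Z.of_nat n)).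

Lemma a_box_from (a b c : R) (n k : nat) (lam : R) (N : nat) :
  a_box a b c n k lam N = box_from a b c n lam N k (Z.of_nat n).
Proof.
  unfold a_box, box_from; rewrite Z.sub_diag; reflexivity.
Qed.

Lemma box_from_0 (a b c : R) (n : nat) (lam : R) (N : nat) (p : Z) :
  box_from a b c n lam N 0 p = Ccoef a b c (p - Z.of_nat n) - Ccoef a b c (p + Z.of_nat n).
Proof.
  unfold box_from, lsum, aterm_from; cbn.
  rewrite Z.add_0_r.
  replace (p - Z.of_nat n + match Z.of_nat n with
             | 0 => 0 | Z.pos y' => Z.pos y'~0 | Z.neg y' => Z.neg y'~0 end)%Z
    with (p + Z.of_nat n)%Z by (change (match Z.of_nat n with
             | 0 => 0 | Z.pos y' => Z.pos y'~0 | Z.neg y' => Z.neg y'~0 end)%Z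
             with (2 * Z.of_nat n)%Z; lia).
  field.
Qed.

(** With [j = p + x], the range [-N, N] of the first step becomes a window of positions centred at
    [p]. The window moves with [p], so the limit of the boxes has to be controlled for all starting
    points at once. *)
Lemma box_from_S (a b c : R) (n : nat) (lam : R) (N k : nat) (p : Z) :
  box_from a b c n lam N (S k) p
    = isum (fun j => Ccoef a b c (j - p) * diag n lam j * box_from a b c n lam N k j)
        (p - Z.of_nat N) (2 * N + 1).
Proof.
  unfold box_from at 1; cbn [tuples].
  replace (p - Z.of_nat N)%Z with (p + - Z.of_nat N)%Z by lia.
  rewrite <- isum_shift, <- lsum_zrange.
  induction (zrange N) as [|x r IH]; [reflexivity|].
  cbn [flat_map]; rewrite lsum_app, IH.
  unfold lsum at 3; cbn [map fold_right]; f_equal.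
  replace (p + x - p)%Z with x by lia.
  unfold box_from; rewrite <- lsum_scal.
  unfold lsum; rewrite map_map; f_equal; apply map_ext; intros l.
  rewrite aterm_from_cons.
  replace (Z.of_nat n + (p - Z.of_nat n) + x)%Z with (p + x)%Z by lia.
  replace (p - Z.of_nat n + x)%Z with (p + x - Z.of_nat n)%Z by lia.
  reflexivity.
Qed.

(* All sequences involved are odd in the position, so position [0] can be dropped. *)
Definition diagn (n : nat) (lam : R) (j : nat) : R :=
  if Nat.eq_dec j 0 then 0 else diag n lam (Z.of_nat j).

(* The limit of the box sums over [k]-step tuples started at position [p], written as a sum over
   the positive positions only; [walk k n] is the paper's [a_k]. *)
Fixpoint walk (a b c : R) (n : nat) (lam : R) (k : nat) (p : Z) : R :=
  match k with
  | O => Ccoef a b c (p - Z.of_nat n) - Ccoef a b c (p + Z.of_nat n)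
  | S k' => Series (fun j => (Ccoef a b c (Z.of_nat j - p) - Ccoef a b c (Z.of_nat j + p))
              * (diagn n lam j * walk a b c n lam k' (Z.of_nat j)))
  end.

(** Evenness of the C's exchanges the two terms of each difference. This is what merges the
    contributions of positions j and -j and makes position 0 contribute nothing. *)
Lemma walk_odd (a b c : R) (n : nat) (lam : R) (k : nat) (p : Z) :
  walk a b c n lam k (- p) = - walk a b c n lam k p.
Proof.
  destruct k as [|k]; cbn [walk].
  - rewrite <- (Ccoef_even _ _ _ (- p - Z.of_nat n)), <- (Ccoef_even _ _ _ (- p + Z.of_nat n)).
    replace (- (- p - Z.of_nat n))%Z with (p + Z.of_nat n)%Z by lia.
    replace (- (- p + Z.of_nat n))%Z with (p - Z.of_nat n)%Z by lia.
    ring.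
  - rewrite <- Series_opp; apply Series_ext; intros j.
    replace (Z.of_nat j - - p)%Z with (Z.of_nat j + p)%Z by lia.
    replace (Z.of_nat j + - p)%Z with (Z.of_nat j - p)%Z by lia.
    ring.
Qed.

Section Boxes.
Variables (a b c M : R) (n : nat) (lam : R).
Hypothesis Hc : 0 < c < PI.
Hypothesis Hq : forall x, Rabs (q a b c x) <= M.
Hypothesis Hdiag : summable (diagn n lam).

Local Lemma M_pos : 0 <= M.
Proof. eapply Rle_trans; [apply Rabs_pos | apply (Hq 0)]. Qed.

Local Lemma term_bound (B : R) (be : Z -> R) (p : Z) (j : nat) :
  (forall x, Rabs (be x) <= B) ->
  Rabs ((Ccoef a b c (Z.of_nat j - p) - Ccoef a b c (Z.of_nat j + p))
    * (diagn n lam j * be (Z.of_nat j))) <= 2 * M * B * Rabs (diagn n lam j).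
Proof.
  intros HB; rewrite !Rabs_mult.
  assert (H1 : Rabs (Ccoef a b c (Z.of_nat j - p) - Ccoef a b c (Z.of_nat j + p)) <= 2 * M).
  { eapply Rle_trans; [apply Rabs_triang|]; rewrite Rabs_Ropp.
    pose proof (Ccoef_bound a b c M (Z.of_nat j - p) Hc Hq).
    pose proof (Ccoef_bound a b c M (Z.of_nat j + p) Hc Hq); lra. }
  replace (2 * M * B * Rabs (diagn n lam j)) with (2 * M * (Rabs (diagn n lam j) * B)) by ring.
  apply Rmult_le_compat; try apply Rabs_pos; [|exact H1|].
  - apply Rmult_le_pos; apply Rabs_pos.
  - apply Rmult_le_compat_l; [apply Rabs_pos | apply HB].
Qed.

Local Lemma term_summable (B : R) (be : Z -> R) (p : Z) :
  (forall x, Rabs (be x) <= B) ->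
  ex_series (fun j => (Ccoef a b c (Z.of_nat j - p) - Ccoef a b c (Z.of_nat j + p))
    * (diagn n lam j * be (Z.of_nat j))).
Proof.
  intros HB; apply ex_series_dominated with (fun j => 2 * M * B * Rabs (diagn n lam j)).
  - intros j; apply term_bound, HB.
  - apply (ex_series_scal (2 * M * B) (fun j => Rabs (diagn n lam j))), Hdiag.
Qed.

Lemma walk_bounded (k : nat) : exists B, forall p, Rabs (walk a b c n lam k p) <= B.
Proof.
  induction k as [|k [B HB]].
  - exists (2 * M); intros p; cbn [walk].
    eapply Rle_trans; [apply Rabs_triang|]; rewrite Rabs_Ropp.
    pose proof (Ccoef_bound a b c M (p - Z.of_nat n) Hc Hq).
    pose proof (Ccoef_bound a b c M (p + Z.of_nat n) Hc Hq); lra.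
  - exists (2 * M * B * Series (fun j => Rabs (diagn n lam j))); intros p; cbn [walk].
    assert (Hs : ex_series (fun j => 2 * M * B * Rabs (diagn n lam j)))
      by (apply (ex_series_scal (2 * M * B) (fun j => Rabs (diagn n lam j))), Hdiag).
    eapply Rle_trans; [apply Series_Rabs|].
    + apply ex_series_dominated with (fun j => 2 * M * B * Rabs (diagn n lam j)); [|exact Hs].
      intros j; rewrite Rabs_Rabsolu; apply term_bound, HB.
    + rewrite <- Series_scal_l; apply Series_le; [|exact Hs].
      intros j; split; [apply Rabs_pos | apply term_bound, HB].
Qed.

Local Lemma diag_isum_bounded :
  exists D, 0 <= D /\ forall lo len, isum (fun p => Rabs (diag n lam p)) lo len <= D.
Proof.
  exists (Rabs (diag n lam 0) + 2 * Series (fun j => Rabs (diagn n lam j))).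
  assert (H : forall lo len, isum (fun p => Rabs (diag n lam p)) lo len
      <= Rabs (diag n lam 0) + 2 * Series (fun j => Rabs (diagn n lam j))).
  { intros lo len; set (J := Z.to_nat (Z.abs lo + Z.of_nat len)).
    eapply Rle_trans; [apply (isum_sub _ lo len J); [intros; apply Rabs_pos | unfold J; lia]|].
    assert (E : forall J, isum (fun p => Rabs (diag n lam p)) (- Z.of_nat J) (2 * J + 1)
        = Rabs (diag n lam 0) + 2 * sum_f_R0 (fun j => Rabs (diagn n lam j)) J).
    { intros K; rewrite isum_symmetric; induction K as [|K IH].
      - cbn; rewrite Rabs_R0; ring.
      - cbn [sum_f_R0]; rewrite diag_even.
        replace (diagn n lam (S K)) with (diag n lam (Z.of_nat (S K))); [lra|].
        unfold diagn; destruct (Nat.eq_dec (S K) 0); [lia | reflexivity]. }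
    rewrite E; apply Rplus_le_compat_l, Rmult_le_compat_l; [lra|].
    apply sum_le_Series; [intros; apply Rabs_pos | exact Hdiag]. }
  split; [|exact H].
  eapply Rle_trans; [|apply (H 0%Z 0%nat)]; cbn; lra.
Qed.

(** Oddness of [be] unfolds the partial sums over positive modes into sums over [-J, J]. Once this
    interval contains the window, the leftover positions satisfy |j - p| > N, where C is at most a
    constant over N + 1, and the total weight of [diag] is at most [D]. *)
Local Lemma truncation_error (B D : R) (be : Z -> R) (N : nat) (p : Z) :
  (forall x, Rabs (be x) <= B) -> (forall x, be (- x)%Z = - be x) ->
  (forall lo len, isum (fun p => Rabs (diag n lam p)) lo len <= D) ->
  Rabs (Series (fun j => (Ccoef a b c (Z.of_nat j - p) - Ccoef a b c (Z.of_nat j + p))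
          * (diagn n lam j * be (Z.of_nat j)))
        - isum (fun j => Ccoef a b c (j - p) * diag n lam j * be j) (p - Z.of_nat N) (2 * N + 1))
    <= (Rabs a + Rabs b) * B * D * / (INR N + 1).
Proof.
  intros HB Hodd HD.
  set (h := fun j => Ccoef a b c (j - p) * diag n lam j * be j).
  set (L := (Rabs a + Rabs b) * / (INR N + 1)).
  assert (HB0 : 0 <= B) by (eapply Rle_trans; [apply Rabs_pos | apply (HB 0%Z)]).
  assert (HL : 0 <= L).
  { unfold L; pose proof (Rabs_pos a); pose proof (Rabs_pos b); pose proof (pos_INR N).
    apply Rmult_le_pos; [lra | apply Rlt_le, Rinv_0_lt_compat; lra]. }
  assert (Hbe0 : be 0%Z = 0) by (specialize (Hodd 0%Z); cbn in Hodd; lra).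
  assert (E : forall J, sum_f_R0 (fun j =>
      (Ccoef a b c (Z.of_nat j - p) - Ccoef a b c (Z.of_nat j + p))
        * (diagn n lam j * be (Z.of_nat j))) J = isum h (- Z.of_nat J) (2 * J + 1)).
  { intros J; rewrite isum_symmetric; unfold h at 3.
    rewrite Hbe0, Rmult_0_r, Rminus_0_r; apply sum_eq; intros j _.
    unfold h; rewrite Hodd, diag_even, <- (Ccoef_even _ _ _ (- Z.of_nat j - p)).
    replace (- (- Z.of_nat j - p))%Z with (Z.of_nat j + p)%Z by lia.
    unfold diagn; destruct (Nat.eq_dec j 0) as [-> | _]; [cbn; rewrite Hbe0|]; ring. }
  assert (Hlim := Series_sum _ (term_summable B be p HB)).
  assert (L1 : is_lim_seq (fun J => Rabs (isum h (- Z.of_nat J) (2 * J + 1)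
      - isum h (p - Z.of_nat N) (2 * N + 1)))
      (Rabs (Series (fun j => (Ccoef a b c (Z.of_nat j - p) - Ccoef a b c (Z.of_nat j + p))
        * (diagn n lam j * be (Z.of_nat j))) - isum h (p - Z.of_nat N) (2 * N + 1)))).
  { apply (is_lim_seq_abs _ (Finite _)), is_lim_seq_minus'; [|apply is_lim_seq_const].
    eapply is_lim_seq_ext; [exact E | exact Hlim]. }
  refine (is_lim_seq_le_loc _ _ _ (Finite ((Rabs a + Rabs b) * B * D * / (INR N + 1))) _ L1
    (is_lim_seq_const _)).
  exists (Z.to_nat (Z.abs (p - Z.of_nat N) + Z.of_nat (2 * N + 1))); intros J HJ.
  apply Rle_trans with (isum (fun x => L * B * Rabs (diag n lam x)) (- Z.of_nat J) (2 * J + 1)).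
  - apply isum_compare; [| |lia].
    + intros x; apply Rmult_le_pos; [now apply Rmult_le_pos | apply Rabs_pos].
    + intros x Hx; unfold h; rewrite !Rabs_mult.
      replace (L * B * Rabs (diag n lam x)) with (L * Rabs (diag n lam x) * B) by ring.
      apply Rmult_le_compat; try apply Rabs_pos; [apply Rmult_le_pos; apply Rabs_pos | |apply HB].
      apply Rmult_le_compat_r; [apply Rabs_pos|].
      apply Ccoef_decay; [exact Hc | lia].
  - rewrite isum_scal.
    replace ((Rabs a + Rabs b) * B * D * / (INR N + 1)) with (L * B * D) by (unfold L; ring).
    apply Rmult_le_compat_l; [now apply Rmult_le_pos | apply HD].
Qed.

(* The rate is uniform in the starting point [p]; this is what lets the induction on [k] go through. *)
Lemma box_from_rate (k : nat) :
  exists E, 0 <= E /\ forall N p,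
    Rabs (box_from a b c n lam N k p - walk a b c n lam k p) <= E * / (INR N + 1).
Proof.
  destruct diag_isum_bounded as [D [HD0 HD]].
  induction k as [|k [E [HE0 HE]]].
  - exists 0; split; [lra|]; intros N p.
    rewrite box_from_0; cbn [walk]; rewrite Rminus_diag, Rabs_R0; lra.
  - destruct (walk_bounded k) as [B HB].
    assert (HB0 : 0 <= B) by (eapply Rle_trans; [apply Rabs_pos | apply (HB 0%Z)]).
    pose proof M_pos as HM; pose proof (Rabs_pos a) as Ha; pose proof (Rabs_pos b) as Hb.
    exists (M * E * D + (Rabs a + Rabs b) * B * D); split.
    { apply Rplus_le_le_0_compat; repeat apply Rmult_le_pos; lra. }
    intros N p; rewrite box_from_S; cbn [walk].
    set (h := fun j => Ccoef a b c (j - p) * diag n lam j * walk a b c n lam k j).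
    set (hN := fun j => Ccoef a b c (j - p) * diag n lam j * box_from a b c n lam N k j).
    assert (Hi : 0 < / (INR N + 1)) by (apply Rinv_0_lt_compat; pose proof (pos_INR N); lra).
    (* [T1] propagates the error of the shorter walks inside the window; [T2] is the error of
       cutting the sum down to the window. *)
    assert (T1 : Rabs (isum hN (p - Z.of_nat N) (2 * N + 1) - isum h (p - Z.of_nat N) (2 * N + 1))
        <= M * E * D * / (INR N + 1)).
    { rewrite <- isum_minus.
      eapply Rle_trans; [apply (isum_dominated _
        (fun j => M * (E * / (INR N + 1)) * Rabs (diag n lam j)))|].
      - intros j _; unfold h, hN; rewrite <- Rmult_minus_distr_l, !Rabs_mult.
        replace (M * (E * / (INR N + 1)) * Rabs (diag n lam j))
          with (M * Rabs (diag n lam j) * (E * / (INR N + 1))) by ring.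
        apply Rmult_le_compat; try apply Rabs_pos; [apply Rmult_le_pos; apply Rabs_pos | |apply HE].
        apply Rmult_le_compat_r; [apply Rabs_pos | apply Ccoef_bound; assumption].
      - rewrite isum_scal.
        replace (M * E * D * / (INR N + 1)) with (M * (E * / (INR N + 1)) * D) by ring.
        apply Rmult_le_compat_l; [|apply HD].
        apply Rmult_le_pos; [exact HM | apply Rmult_le_pos; lra]. }
    assert (T2 := truncation_error B D (walk a b c n lam k) N p HB
      (walk_odd a b c n lam k) HD).
    fold h in T2.
    rewrite Rmult_plus_distr_r.
    match goal with |- Rabs (?x - ?s) <= _ =>
      replace (x - s) with ((x - isum h (p - Z.of_nat N) (2 * N + 1))
        + - (s - isum h (p - Z.of_nat N) (2 * N + 1))) by ring end.
    eapply Rle_trans; [apply Rabs_triang|]; rewrite Rabs_Ropp.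
    apply Rplus_le_compat; [exact T1 | exact T2].
Qed.

Lemma a_box_lim (k : nat) :
  is_lim_seq (a_box a b c n k lam) (walk a b c n lam k (Z.of_nat n)).
Proof.
  destruct (box_from_rate k) as [E [_ HE]].
  set (w := walk a b c n lam k (Z.of_nat n)).
  apply is_lim_seq_ext with (fun N => (a_box a b c n k lam N - w) + w); [intros; ring|].
  replace (Finite w) with (Finite (0 + w)) by (f_equal; ring).
  apply is_lim_seq_plus'; [|apply is_lim_seq_const].
  apply is_lim_seq_abs_0.
  apply is_lim_seq_le_le with (fun _ => 0) (fun N => E * / (INR N + 1)).
  - intros N; split; [apply Rabs_pos|]; rewrite a_box_from; apply HE.
  - apply is_lim_seq_const.
  - replace (Finite 0) with (Finite (E * 0)) by (f_equal; ring).
    apply is_lim_seq_mult'; [apply is_lim_seq_const|].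
    replace (Finite 0) with (Rbar_inv p_infty) by reflexivity.
    apply is_lim_seq_inv; [|discriminate].
    eapply is_lim_seq_plus; [apply is_lim_seq_INR | apply is_lim_seq_const | reflexivity].
Qed.

End Boxes.

(** * The reduced equation for a solution *)

Lemma is_series_single (n : nat) (x : R) :
  is_series (fun j => if Nat.eq_dec j n then x else 0) x.
Proof.
  apply is_series_sum.
  apply is_lim_seq_ext_loc with (fun _ => x); [|apply is_lim_seq_const].
  exists n; intros N HN; induction HN as [|N HN IH].
  - etransitivity; [symmetry; apply (sum_indicator (fun _ => x) n)|]; apply sum_eq; intros j _.
    destruct (Nat.eq_dec j n); ring.
  - cbn [sum_f_R0]; rewrite IH at 1; destruct (Nat.eq_dec (S N) n); [lia | ring].
Qed.

Lemma diagn_summable (n : nat) (lam g : R) :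
  0 < g ->
  (forall j, (1 <= j)%nat -> j <> n -> g <= Rabs (lam - INR j ^ 2)) ->
  summable (diagn n lam) /\ forall j, Rabs (diagn n lam j) <= / g.
Proof.
  intros Hg Hgap.
  assert (Hg' : 0 < / g) by now apply Rinv_0_lt_compat.
  assert (H : forall j, (diagn n lam j = 0) \/
    ((1 <= j)%nat /\ j <> n /\ diagn n lam j = / (lam - INR j ^ 2))).
  { intros j; unfold diagn, diag; destruct (Nat.eq_dec j 0); [now left|].
    rewrite <- INR_IZR_INZ.
    destruct (Z.eqb_spec (Z.of_nat j) (Z.of_nat n)); [now left|].
    destruct (Z.eqb_spec (Z.of_nat j) (- Z.of_nat n)); [now left|].
    right; repeat split; lia. }
  split.
  - apply ex_series_dominated with (fun j => (1 + Rabs lam * / g) * / INR j ^ 2).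
    + intros j; rewrite Rabs_Rabsolu.
      assert (Hlam : 0 <= Rabs lam * / g) by (apply Rmult_le_pos; [apply Rabs_pos | lra]).
      destruct (H j) as [-> | (Hj & Hjn & ->)].
      * rewrite Rabs_R0; apply Rmult_le_pos; [lra|].
        eapply Rle_trans; [apply Rabs_pos | apply (cos_term_bound 0)].
      * specialize (Hgap j Hj Hjn); set (X := Rabs (lam - INR j ^ 2)) in *.
        rewrite Rabs_inv; fold X.
        assert (Hj1 : 0 < INR j) by (apply lt_0_INR; lia).
        assert (Hj2 : 0 < INR j ^ 2) by now apply pow_lt.
        (* The gap gives 1 <= X / g, which converts j^2 <= X + |lam| into a multiple of X and so
           yields a majorant of order 1/j^2. *)
        assert (Hle : INR j ^ 2 <= X * (1 + Rabs lam * / g)).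
        { apply Rle_trans with (X + Rabs lam).
          - rewrite <- (Rabs_pos_eq (INR j ^ 2)) by lra.
            replace (INR j ^ 2) with (- (lam - INR j ^ 2) + lam) at 1 by ring.
            eapply Rle_trans; [apply Rabs_triang|]; rewrite Rabs_Ropp; unfold X; lra.
          - assert (1 <= X * / g).
            { rewrite <- (Rinv_r g) by lra; apply Rmult_le_compat_r; lra. }
            pose proof (Rabs_pos lam); nra. }
        apply Rmult_le_reg_l with X; [lra|]; rewrite Rinv_r by lra.
        apply Rmult_le_reg_r with (INR j ^ 2); [lra|].
        replace (X * ((1 + Rabs lam * / g) * / INR j ^ 2) * INR j ^ 2)
          with (X * (1 + Rabs lam * / g)) by (field; lra).
        lra.
    + apply (ex_series_scal (1 + Rabs lam * / g) (fun j => / INR j ^ 2)), ex_series_inv_sqr.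
  - intros j; destruct (H j) as [-> | (Hj & Hjn & ->)]; [rewrite Rabs_R0; lra|].
    rewrite Rabs_inv; apply Rinv_le_contravar; [lra | now apply Hgap].
Qed.

Section Reduction.
Variables (a b c M lam g : R) (n : nat).
Hypothesis Hc : 0 < c < PI.
Hypothesis Hbal : a * c + b * (PI - c) = 0.
Hypothesis HM : 0 < M.
Hypothesis Hq : forall x, Rabs (q a b c x) <= M.
Hypothesis Hn : (1 <= n)%nat.
Hypothesis HMg : M < g.
Hypothesis Hgap : forall j, (1 <= j)%nat -> j <> n -> g <= Rabs (lam - INR j ^ 2).

Let dd := diagn n lam.
Let T := reduced a b c dd.
Let rho := M * / g.

Local Lemma dd_summable : summable dd.
Proof. apply (diagn_summable n lam g); [lra | exact Hgap]. Qed.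

Local Lemma dd_bound (j : nat) : Rabs (dd j) <= / g.
Proof. apply (diagn_summable n lam g); [lra | exact Hgap]. Qed.

Local Lemma g_inv_pos : 0 < / g.
Proof. apply Rinv_0_lt_compat; lra. Qed.

Local Lemma rho_lt_1 : 0 < rho < 1.
Proof.
  unfold rho; pose proof g_inv_pos; split; [apply Rmult_lt_0_compat; lra|].
  rewrite <- (Rinv_r g) by lra; apply Rmult_lt_compat_r; lra.
Qed.

(** [walk 0] is the matrix column of mode n, so [P k] collects the forcing by mode n after k further
    passes of the operator. *)
Let P (k : nat) : nat -> R := Nat.iter k T (fun j => dd j * walk a b c n lam 0 (Z.of_nat j)).

Local Lemma iter_T (v : nat -> R) (be : R) (K : nat) :
  summable v -> energy_le v be ->
  summable (Nat.iter K T v) /\ energy_le (Nat.iter K T v) (rho ^ K * be).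
Proof.
  apply iter_reduced; [exact Hc | exact HM | exact Hq | exact g_inv_pos | exact dd_bound
    | exact dd_summable].
Qed.

Local Lemma apply_q_ext (u v : nat -> R) (m : nat) :
  (forall j, u j = v j) -> apply_q a b c u m = apply_q a b c v m.
Proof. intros H; apply Series_ext; intros j; now rewrite H. Qed.

(** By induction [P k j] is [dd j] times the k-step walk from j. At [m = n] this identifies a_(k+1)
    with the mode n component of q applied to the k-th iterate, so the contraction bounds a_k
    geometrically. *)
Local Lemma walk_apply_q (k m : nat) :
  walk a b c n lam (S k) (Z.of_nat m) = apply_q a b c (P k) m.
Proof.
  revert m; induction k as [|k IH]; intros m.
  - apply Series_ext; intros j; rewrite smatrix_Ccoef by exact Hc; reflexivity.
  - transitivity (Series (fun j => smatrix a b c m j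
        * (dd j * walk a b c n lam (S k) (Z.of_nat j)))).
    + apply Series_ext; intros j; rewrite smatrix_Ccoef by exact Hc; reflexivity.
    + apply Series_ext; intros j; rewrite IH; reflexivity.
Qed.

Local Lemma P0_summable : summable (P 0).
Proof.
  destruct (walk_bounded a b c M n lam Hc Hq dd_summable 0) as [B HB].
  apply ex_series_dominated with (fun j => B * Rabs (dd j)).
  - intros j; rewrite Rabs_Rabsolu; unfold P; cbn [Nat.iter nat_rect].
    rewrite Rabs_mult, Rmult_comm.
    apply Rmult_le_compat_r; [apply Rabs_pos | apply HB].
  - apply (ex_series_scal B (fun j => Rabs (dd j))), dd_summable.
Qed.

Local Lemma geometric_bound (v : nat -> R) :
  summable v -> exists be, 0 < be /\
    forall K, summable (Nat.iter K T v) /\ energy_le (Nat.iter K T v) (rho ^ K * be) /\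
      Rabs (apply_q a b c (Nat.iter K T v) n) <= M * (rho ^ K * be).
Proof.
  intros Hv; destruct (summable_energy v Hv) as [be [Hbe He]].
  exists be; split; [exact Hbe|]; intros K.
  destruct (iter_T v be K Hv He) as [H1 H2]; repeat split; try assumption.
  apply apply_q_bound; try assumption.
  apply Rmult_lt_0_compat; [apply pow_lt, rho_lt_1 | exact Hbe].
Qed.

Local Lemma geometric_to_0 (k : R) : is_lim_seq (fun K => M * (rho ^ K * k)) 0.
Proof.
  replace (Finite 0) with (Finite (M * (0 * k))) by (f_equal; ring).
  apply is_lim_seq_mult'; [apply is_lim_seq_const|].
  apply is_lim_seq_mult'; [|apply is_lim_seq_const].
  apply is_lim_seq_geom; pose proof rho_lt_1; rewrite Rabs_pos_eq; lra.
Qed.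

Lemma ex_series_walk : ex_series (fun k => walk a b c n lam (S k) (Z.of_nat n)).
Proof.
  destruct (geometric_bound (P 0) P0_summable) as [be [_ H]].
  apply ex_series_dominated with (fun K => M * be * rho ^ K).
  - intros k; rewrite walk_apply_q; destruct (H k) as (_ & _ & Hk).
    replace (M * be * rho ^ k) with (M * (rho ^ k * be)) by ring; exact Hk.
  - apply (ex_series_scal (M * be) (fun k => rho ^ k)), ex_series_geom.
    pose proof rho_lt_1; rewrite Rabs_pos_eq; lra.
Qed.

Variables (tau : R) (y y' : R -> R).
Hypothesis Hsol : is_solution a b c lam tau n y y'.
Hypothesis Hy0 : y 0 = 0.
Hypothesis HyPI : y PI = 0.

Let Y := scoef y.
Let w (j : nat) : R := if Nat.eq_dec j n then 0 else Y j.
Let r (K : nat) : nat -> R := Nat.iter K T w.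

Local Lemma Y_summable : summable Y.
Proof.
  destruct (scoef_decay a b c lam tau n y y' Hc Hsol Hy0 HyPI) as [K HK].
  apply ex_series_dominated with (fun j => K * / INR j ^ 2).
  - intros j; rewrite Rabs_Rabsolu; apply HK.
  - apply (ex_series_scal K (fun j => / INR j ^ 2)), ex_series_inv_sqr.
Qed.

Local Lemma w_summable : summable w.
Proof.
  apply ex_series_dominated with (fun j => Rabs (Y j)); [|exact Y_summable].
  intros j; rewrite Rabs_Rabsolu; unfold w; destruct (Nat.eq_dec j n); [|lra].
  rewrite Rabs_R0; apply Rabs_pos.
Qed.

Local Lemma apply_q_split (m : nat) :
  apply_q a b c Y m = apply_q a b c w m + Y n * walk a b c n lam 0 (Z.of_nat m).
Proof.
  set (e := fun j => if Nat.eq_dec j n then 1 else 0).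
  assert (He : summable e).
  { exists 1; apply is_series_ext with (fun j => if Nat.eq_dec j n then 1 else 0);
      [|apply is_series_single].
    intros j; unfold e; destruct (Nat.eq_dec j n); [rewrite Rabs_R1 | rewrite Rabs_R0]; reflexivity. }
  rewrite (apply_q_ext Y (fun j => w j + Y n * e j)).
  - rewrite (apply_q_linear a b c M) by (assumption || exact w_summable).
    do 2 f_equal; apply is_series_unique.
    apply is_series_ext with (fun j => if Nat.eq_dec j n
      then walk a b c n lam 0 (Z.of_nat m) else 0); [|apply is_series_single].
    intros j; unfold e; destruct (Nat.eq_dec j n) as [-> | _]; [|cbn; ring].
    rewrite smatrix_Ccoef by exact Hc; cbn [walk]; rewrite Rmult_1_r.
    rewrite <- (Ccoef_even _ _ _ (Z.of_nat n - Z.of_nat m)).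
    f_equal; f_equal; lia.
  - intros j; unfold w, e; destruct (Nat.eq_dec j n) as [-> | _]; ring.
Qed.

Local Lemma Y_equation (m : nat) :
  (lam - INR m ^ 2) * Y m = apply_q a b c Y m - tau * (if Nat.eq_dec m n then 1 else 0).
Proof.
  unfold Y; rewrite (mode_equation a b c lam tau n y y' Hc Hsol Hy0 HyPI m Hn); f_equal.
  symmetry; apply is_series_unique, (smatrix_expansion a b c lam tau n y y'); assumption.
Qed.

(** The mode equation divided by lam - j^2, which the gap keeps away from 0. At [j = 0] and [j = n]
    the weight [dd j] and the left side both vanish. *)
Local Lemma w_fixed_point (j : nat) : w j = T w j + Y n * P 0 j.
Proof.
  unfold T, reduced, P; cbn [Nat.iter nat_rect]; unfold w at 1, dd, diagn, diag.
  destruct (Nat.eq_dec j 0) as [-> | Hj0].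
  { unfold Y; rewrite scoef_0; destruct (Nat.eq_dec 0 n); ring. }
  rewrite <- INR_IZR_INZ.
  destruct (Nat.eq_dec j n) as [-> | Hjn].
  { rewrite Z.eqb_refl; cbn [negb andb]; ring. }
  destruct (Z.eqb_spec (Z.of_nat j) (Z.of_nat n)); [lia|].
  destruct (Z.eqb_spec (Z.of_nat j) (- Z.of_nat n)); [lia|]; cbn [negb andb].
  assert (Hne : lam - INR j ^ 2 <> 0).
  { intros E; specialize (Hgap j ltac:(lia) Hjn); rewrite E, Rabs_R0 in Hgap; lra. }
  assert (E := Y_equation j); rewrite apply_q_split in E.
  destruct (Nat.eq_dec j n); [lia|].
  apply (Rmult_eq_reg_l (lam - INR j ^ 2)); [|exact Hne]; rewrite E; field; exact Hne.
Qed.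

Local Lemma r_step (K j : nat) : r K j = r (S K) j + Y n * P K j.
Proof.
  revert j; induction K as [|K IH]; intros j; [apply w_fixed_point|].
  destruct (geometric_bound w w_summable) as [be1 [_ H1]].
  destruct (geometric_bound (P 0) P0_summable) as [be2 [_ H2]].
  change (dd j * apply_q a b c (r K) j
    = dd j * apply_q a b c (r (S K)) j + Y n * (dd j * apply_q a b c (P K) j)).
  rewrite (apply_q_ext (r K) (fun i => r (S K) i + Y n * P K i)) by exact IH.
  rewrite (apply_q_linear a b c M); try assumption; [ring | apply H1 | apply (H2 K)].
Qed.

(** The Neumann expansion stopped after finitely many steps; its remainder [r (S K)] is
    geometrically small by the contraction. *)
Local Lemma apply_q_w_partial (K : nat) :
  apply_q a b c w n = apply_q a b c (r (S K)) n
    + Y n * sum_f_R0 (fun k => walk a b c n lam (S k) (Z.of_nat n)) K.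
Proof.
  destruct (geometric_bound w w_summable) as [be1 [_ H1]].
  destruct (geometric_bound (P 0) P0_summable) as [be2 [_ H2]].
  assert (St : forall K, apply_q a b c (r K) n = apply_q a b c (r (S K)) n
      + Y n * walk a b c n lam (S K) (Z.of_nat n)).
  { intros k; rewrite (apply_q_ext (r k) (fun i => r (S k) i + Y n * P k i)) by apply r_step.
    rewrite (apply_q_linear a b c M), walk_apply_q; try assumption;
      [reflexivity | apply (H1 (S k)) | apply (H2 k)]. }
  induction K as [|K IH]; [apply (St 0%nat)|].
  rewrite IH, (St (S K)); cbn [sum_f_R0]; ring.
Qed.

Lemma reduced_equation :
  (lam - INR n ^ 2 + Ccoef a b c (2 * Z.of_nat n)
    - Series (fun k => walk a b c n lam (S k) (Z.of_nat n))) * scoef y n = - tau.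
Proof.
  set (F := Series (fun k => walk a b c n lam (S k) (Z.of_nat n))).
  assert (Hw : apply_q a b c w n = Y n * F).
  { destruct (geometric_bound w w_summable) as [be [_ H]].
    assert (L1 : is_lim_seq (fun K => apply_q a b c (r (S K)) n) 0).
    { apply is_lim_seq_abs_0.
      apply is_lim_seq_le_le with (fun _ => 0) (fun K => M * (rho ^ S K * be)).
      - intros K; split; [apply Rabs_pos | apply (H (S K))].
      - apply is_lim_seq_const.
      - apply (is_lim_seq_incr_1 (fun K => M * (rho ^ K * be))), geometric_to_0. }
    assert (L2 : is_lim_seq (fun K => apply_q a b c (r (S K)) n
        + Y n * sum_f_R0 (fun k => walk a b c n lam (S k) (Z.of_nat n)) K) (0 + Y n * F)).
    { apply is_lim_seq_plus'; [exact L1|].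
      apply is_lim_seq_mult'; [apply is_lim_seq_const | apply Series_sum, ex_series_walk]. }
    apply (is_lim_seq_ext _ (fun _ => apply_q a b c w n)) in L2;
      [|intros K; symmetry; apply apply_q_w_partial].
    apply is_lim_seq_unique in L2; rewrite Lim_seq_const in L2.
    injection L2; lra. }
  assert (E := Y_equation n); rewrite apply_q_split, Hw in E.
  destruct (Nat.eq_dec n n); [|lia].
  (* The zero mean of the potential removes C_0 from the diagonal entry at mode n, so that only -
     C_(2n) is left. *)
  cbn [walk] in E; rewrite Z.sub_diag, Ccoef_0 in E by assumption.
  replace (Z.of_nat n + Z.of_nat n)%Z with (2 * Z.of_nat n)%Z in E by lia.
  fold Y; lra.
Qed.

(** Without forcing, [w] equals all its iterates, so its l^2 bound carries the factor rho^K for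
    every K and all modes vanish. The sine expansion carries this over to [y]. *)
Lemma trivial_mode_trivial_solution :
  scoef y n = 0 -> forall x, 0 <= x <= PI -> y x = 0.
Proof.
  intros HYn.
  destruct (geometric_bound w w_summable) as [be [Hbe H]].
  assert (Hr : forall K j, r K j = w j).
  { induction K as [|K IH]; intros j; [reflexivity|].
    rewrite <- IH, (r_step K j); unfold Y; rewrite HYn; ring. }
  assert (Hw : forall j, w j = 0).
  { intros j.
    assert (HK : forall K, Rabs (w j) <= rho ^ K * be).
    { intros K; destruct (H K) as (_ & He & _); specialize (He j).
      assert (w j ^ 2 <= (rho ^ K * be) ^ 2).
      { eapply Rle_trans; [|exact He].
        rewrite (sum_eq _ (fun i => w i ^ 2)) by (intros i _; rewrite <- (Hr K i); reflexivity).
        destruct j as [|j]; cbn [sum_f_R0]; [lra|].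
        assert (0 <= sum_f_R0 (fun i => w i ^ 2) j)
          by (apply cond_pos_sum; intros; apply pow2_ge_0).
        lra. }
      assert (0 < rho ^ K * be) by (apply Rmult_lt_0_compat; [apply pow_lt, rho_lt_1 | exact Hbe]).
      apply Rabs_le; split; nra. }
    assert (L : is_lim_seq (fun K => M * (rho ^ K * be)) 0) by apply geometric_to_0.
    assert (Hle : Rbar_le (M * Rabs (w j)) 0).
    { refine (is_lim_seq_le (fun _ => M * Rabs (w j)) _ _ _ _ (is_lim_seq_const _) L).
      intros K; apply Rmult_le_compat_l; [lra | apply HK]. }
    simpl in Hle; pose proof (Rabs_pos (w j)).
    assert (E : Rabs (w j) = 0) by nra.
    apply Rabs_eq_0, E. }
  assert (HY : forall j, scoef y j = 0).
  { intros j; specialize (Hw j); unfold w in Hw.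
    destruct (Nat.eq_dec j n) as [-> | _]; assumption. }
  intros x Hx.
  rewrite <- (is_series_unique _ _ (sine_expansion a b c lam tau n y y' Hc Hsol Hy0 HyPI x Hx)).
  apply is_series_unique.
  apply is_series_ext with (fun j => if Nat.eq_dec j 0 then 0 else 0); [|apply is_series_single].
  intros j; rewrite HY; destruct (Nat.eq_dec j 0); cbn; ring.
Qed.

End Reduction.

(** * Solvability of the inhomogeneous boundary value problem *)

Lemma fundamental_pair (mu : R) :
  exists S C : R -> R,
    (forall x, is_derive S x (C x)) /\ (forall x, is_derive C x (mu * S x)) /\
    S 0 = 0 /\ C 0 = 1.
Proof.
  destruct (Rtotal_order mu 0) as [Hmu | [-> | Hmu]].
  - set (k := sqrt (- mu)).
    assert (Hk : 0 < k) by (apply sqrt_lt_R0; lra).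
    assert (Hk2 : mu = - (k * k)) by (unfold k; rewrite sqrt_sqrt; lra).
    exists (fun x => sin (k * x) * / k), (fun x => cos (k * x)); split; [|split; [|split]].
    + intros x; auto_derive; [trivial | field; lra].
    + intros x; auto_derive; [trivial | rewrite Hk2; field; lra].
    + rewrite Rmult_0_r, sin_0; ring.
    + rewrite Rmult_0_r; apply cos_0.
  - exists (fun x => x), (fun _ => 1); split; [|split; [|split]]; try reflexivity;
      intros; auto_derive; trivial; ring.
  - set (k := sqrt mu).
    assert (Hk : 0 < k) by (apply sqrt_lt_R0; lra).
    assert (Hk2 : mu = k * k) by (unfold k; rewrite sqrt_sqrt; lra).
    exists (fun x => (exp (k * x) - exp (- k * x)) * / (2 * k)),
      (fun x => (exp (k * x) + exp (- k * x)) / 2); split; [|split; [|split]].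
    + intros x; auto_derive; [trivial | field; lra].
    + intros x; auto_derive; [trivial | rewrite Hk2; field; lra].
    + rewrite !Rmult_0_r; ring.
    + rewrite !Rmult_0_r, exp_0; field.
Qed.

(* At the resonance [mu = - INR n ^ 2] the particular solution grows linearly. *)
Lemma particular_solution (mu tau : R) (n : nat) :
  (1 <= n)%nat ->
  exists u u' : R -> R,
    (forall x, is_derive u x (u' x)) /\
    (forall x, is_derive u' x (mu * u x - tau * sin (INR n * x))).
Proof.
  intros Hn; assert (HN : 0 < INR n) by (apply lt_0_INR; lia).
  destruct (Req_dec (INR n ^ 2 + mu) 0) as [H | H]; revert HN H; generalize (INR n); intros k HN H.
  - replace mu with (- k ^ 2) by lra.
    exists (fun x => tau / (2 * k) * (x * cos (k * x))),
      (fun x => tau / (2 * k) * (cos (k * x) - k * (x * sin (k * x)))); split; intros x;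
      auto_derive; trivial; field; lra.
  - exists (fun x => tau / (k ^ 2 + mu) * sin (k * x)),
      (fun x => tau / (k ^ 2 + mu) * (k * cos (k * x))); split; intros x;
      auto_derive; trivial; field; lra.
Qed.

Lemma initial_value_problem (mu tau : R) (n : nat) (x0 al be : R) :
  (1 <= n)%nat ->
  exists u u' : R -> R,
    (forall x, is_derive u x (u' x)) /\
    (forall x, is_derive u' x (mu * u x - tau * sin (INR n * x))) /\
    u x0 = al /\ u' x0 = be.
Proof.
  intros Hn.
  destruct (fundamental_pair mu) as (S & C & HS & HC & HS0 & HC0).
  destruct (particular_solution mu tau n Hn) as (u & u' & Hu & Hu').
  assert (Hshift : forall (f : R -> R) (l x : R), is_derive f (x - x0) l -> is_derive (fun t => f (t - x0)) x l).
  { intros f l x Hf; replace l with (1 * l) by ring.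
    apply (is_derive_comp f (fun t => t - x0)); [exact Hf|].
    auto_derive; [trivial | ring]. }
  set (A := al - u x0); set (B := be - u' x0).
  exists (fun x => u x + (A * C (x - x0) + B * S (x - x0))),
    (fun x => u' x + (A * (mu * S (x - x0)) + B * C (x - x0))); split; [|split; [|split]].
  - intros x; apply (is_derive_plus u); [apply Hu|].
    apply (is_derive_plus (fun x => A * C (x - x0))).
    + apply (is_derive_scal (fun t => C (t - x0))), Hshift, HC.
    + apply (is_derive_scal (fun t => S (t - x0))), Hshift, HS.
  - intros x.
    replace (mu * (u x + (A * C (x - x0) + B * S (x - x0))) - tau * sin (INR n * x))
      with ((mu * u x - tau * sin (INR n * x))
        + (A * (mu * C (x - x0)) + B * (mu * S (x - x0)))) by ring.
    apply (is_derive_plus u'); [apply Hu'|].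
    apply (is_derive_plus (fun x => A * (mu * S (x - x0)))).
    + apply (is_derive_scal (fun t => mu * S (t - x0))).
      apply (is_derive_scal (fun t => S (t - x0))), Hshift, HS.
    + apply (is_derive_scal (fun t => C (t - x0))), Hshift, HC.
  - rewrite Rminus_diag, HS0, HC0; unfold A; ring.
  - rewrite Rminus_diag, HS0, HC0; unfold B; ring.
Qed.

Definition glue (c : R) (f g : R -> R) (x : R) : R := if Rle_dec x c then f x else g x.

Lemma glue_locally_left (c x : R) (f g : R -> R) :
  x < c -> locally x (fun t => f t = glue c f g t).
Proof.
  intros Hx; apply (filter_imp (fun t => t < c)); [|apply (open_lt c x Hx)].
  intros t Ht; unfold glue; destruct (Rle_dec t c); [reflexivity | lra].
Qed.

Lemma glue_locally_right (c x : R) (f g : R -> R) :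
  c < x -> locally x (fun t => g t = glue c f g t).
Proof.
  intros Hx; apply (filter_imp (fun t => c < t)); [|apply (open_gt c x Hx)].
  intros t Ht; unfold glue; destruct (Rle_dec t c); [lra | reflexivity].
Qed.

Lemma glue_derive (c l : R) (f g : R -> R) :
  f c = g c -> is_derive f c l -> is_derive g c l -> is_derive (glue c f g) c l.
Proof.
  intros E Hf Hg; apply is_derive_Reals in Hf; apply is_derive_Reals in Hg.
  apply is_derive_Reals; intros eps He.
  destruct (Hf eps He) as [d1 H1]; destruct (Hg eps He) as [d2 H2].
  assert (Hd : 0 < Rmin d1 d2) by (apply Rmin_glb_lt; apply cond_pos).
  exists (mkposreal _ Hd); cbn; intros h Hh0 Hh.
  pose proof (Rmin_l d1 d2); pose proof (Rmin_r d1 d2).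
  unfold glue; destruct (Rle_dec c c); [|lra].
  destruct (Rle_dec (c + h) c); [apply H1; lra|].
  rewrite E; apply H2; lra.
Qed.

Lemma glue_continuous (c : R) (f g : R -> R) :
  f c = g c -> continuous f c -> continuous g c -> continuous (glue c f g) c.
Proof.
  intros E Hf Hg; apply filterlim_locally; intros eps.
  assert (H1 := proj1 (filterlim_locally _ _) Hf eps).
  assert (H2 := proj1 (filterlim_locally _ _) Hg eps).
  generalize (filter_and _ _ H1 H2); apply filter_imp; intros t [B1 B2]; unfold glue.
  destruct (Rle_dec c c); [|lra].
  destruct (Rle_dec t c); [exact B1 | rewrite E; exact B2].
Qed.

(** On each side of [c] the equation has constant coefficients. The right piece takes over the value
    and slope of the left piece at [c], so the glued function is C^1 across the jump. *)
Lemma solution_exists (a b c lam tau al : R) (n : nat) :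
  0 < c < PI -> (1 <= n)%nat ->
  exists y y', is_solution a b c lam tau n y y' /\ y 0 = 0 /\ y' 0 = al.
Proof.
  intros Hc Hn.
  destruct (initial_value_problem (a - lam) tau n 0 0 al Hn) as (u & u' & Hu & Hu' & Hu0 & Hu'0).
  destruct (initial_value_problem (b - lam) tau n c (u c) (u' c) Hn)
    as (v & v' & Hv & Hv' & Hvc & Hv'c).
  exists (glue c u v), (glue c u' v'); split; [split; [|split]|split].
  - intros x Hx; destruct (Rtotal_order x c) as [H | [-> | H]].
    + unfold glue at 2; destruct (Rle_dec x c); [|lra].
      apply (is_derive_ext_loc u); [apply glue_locally_left, H | apply Hu].
    + unfold glue at 2; destruct (Rle_dec c c); [|lra].
      apply glue_derive; [now symmetry | apply Hu | rewrite <- Hv'c; apply Hv].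
    + unfold glue at 2; destruct (Rle_dec x c); [lra|].
      apply (is_derive_ext_loc v); [apply glue_locally_right, H | apply Hv].
  - apply glue_continuous; [now symmetry | |];
      [apply (ex_derive_continuous u') | apply (ex_derive_continuous v')];
      eexists; [apply Hu' | apply Hv'].
  - intros x Hx Hxc; unfold q, glue at 2; destruct (Rle_dec x c).
    + apply (is_derive_ext_loc u'); [apply glue_locally_left; lra | apply Hu'].
    + apply (is_derive_ext_loc v'); [apply glue_locally_right; lra | apply Hv'].
  - unfold glue; destruct (Rle_dec 0 c); lra.
  - unfold glue; destruct (Rle_dec 0 c); lra.
Qed.

Lemma solution_combination (a b c lam tau k : R) (n : nat) (y y' z z' : R -> R) :
  is_solution a b c lam tau n y y' -> is_solution a b c lam 0 n z z' ->
  is_solution a b c lam tau n (fun x => y x - k * z x) (fun x => y' x - k * z' x).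
Proof.
  intros (H1 & H2 & H3) (G1 & G2 & G3); split; [|split].
  - intros x Hx; apply (is_derive_minus y); [now apply H1|].
    apply (is_derive_scal z); now apply G1.
  - pose proof H2; pose proof G2; cont.
  - intros x Hx Hxc.
    replace ((q a b c x - lam) * (y x - k * z x) - tau * sin (INR n * x))
      with (((q a b c x - lam) * y x - tau * sin (INR n * x))
        - k * ((q a b c x - lam) * z x - 0 * sin (INR n * x))) by ring.
    apply (is_derive_minus y'); [now apply H3|].
    apply (is_derive_scal z'); now apply G3.
Qed.

(** The slope 1 at 0 excludes the trivial solution: if [y] vanished on [0, PI], its difference
    quotients at 0 with small positive increments would all be 0. *)
Lemma eigenvalue_of_solution (a b c lam : R) (n : nat) (y y' : R -> R) :
  is_solution a b c lam 0 n y y' -> y 0 = 0 -> y PI = 0 -> y' 0 = 1 ->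
  is_eigenvalue a b c lam.
Proof.
  intros (H1 & H2 & H3) H0 HPI Hd; exists y, y'.
  split; [|split; [|split; [|split; [|split]]]]; try assumption.
  - intros x Hx Hxc; replace ((q a b c x - lam) * y x)
      with ((q a b c x - lam) * y x - 0 * sin (INR n * x)) by ring.
    now apply H3.
  - apply NNPP; intros Hno.
    assert (Hz : forall x, 0 <= x <= PI -> y x = 0).
    { intros x Hx; apply NNPP; intros Hy; apply Hno; now exists x. }
    pose proof PI_RGT_0 as Hpi.
    assert (D := H1 0 ltac:(lra)); rewrite Hd in D; apply is_derive_Reals in D.
    destruct (D (/ 2) ltac:(lra)) as [d Hd'].
    set (h := Rmin (d / 2) PI).
    assert (Hh : 0 < h /\ h < d /\ h <= PI).
    { unfold h; pose proof (cond_pos d); pose proof (Rmin_l (d / 2) PI);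
        pose proof (Rmin_r (d / 2) PI); repeat split; try lra; apply Rmin_glb_lt; lra. }
    specialize (Hd' h ltac:(lra)); rewrite Rabs_pos_eq in Hd' by lra.
    specialize (Hd' ltac:(lra)).
    rewrite Rplus_0_l, H0, (Hz h) in Hd' by lra.
    replace ((0 - 0) / h - 1) with (-1) in Hd' by (field; lra).
    rewrite Rabs_left in Hd'; lra.
Qed.

(** * The spectral gap and the equivalence *)

(** The neighbouring squares are at distance 2n - 1 and 2n + 1 from n^2, and [lam] uses up at most M
    of it; 2n - 1 - M > M is the condition on M for n > 1. For n = 1 there is no sine mode below, so
    the nearest one is j = 2, at distance 3. *)
Lemma spectral_gap (n : nat) (M lam : R) :
  0 < M -> (1 <= n)%nat ->
  ((1 < n)%nat -> M < (2 * INR n - 1) / 2) -> (n = 1%nat -> M <= 1 / 2) ->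
  INR n ^ 2 - M <= lam <= INR n ^ 2 + M ->
  exists g, M < g /\ forall j, (1 <= j)%nat -> j <> n -> g <= Rabs (lam - INR j ^ 2).
Proof.
  intros HM Hn H1 H2 Hlam.
  assert (Hup : forall j, (n < j)%nat -> 2 * INR n + 1 - M <= Rabs (lam - INR j ^ 2)).
  { intros j Hj; assert (INR n + 1 <= INR j) by (rewrite <- S_INR; apply le_INR; lia).
    pose proof (pos_INR n); rewrite <- Rabs_Ropp; eapply Rle_trans; [|apply Rle_abs]; nra. }
  destruct (Nat.eq_dec n 1) as [-> | Hn1].
  - specialize (H2 eq_refl); exists (3 - M); split; [lra|]; intros j Hj Hj1.
    specialize (Hup j ltac:(lia)); change (INR 1) with 1 in Hup; lra.
  - specialize (H1 ltac:(lia)); exists (2 * INR n - 1 - M); split; [lra|]; intros j Hj Hjn.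
    destruct (Nat.lt_ge_cases n j) as [H | H]; [specialize (Hup j H); lra|].
    assert (INR j + 1 <= INR n) by (rewrite <- S_INR; apply le_INR; lia).
    pose proof (pos_INR j); eapply Rle_trans; [|apply Rle_abs]; nra.
Qed.

Theorem theorem3 (a b c : R) (n : nat) (M : R) :
  a < b -> 0 < c < PI -> a * c + b * (PI - c) = 0 ->
  M = Rmax (Rabs a) b ->
  (1 <= n)%nat ->
  ((1 < n)%nat -> M < (2 * INR n - 1) / 2) ->
  (n = 1%nat -> M <= 1 / 2) ->
  forall lam : R, (INR n) ^ 2 - M <= lam <= (INR n) ^ 2 + M ->
    (is_eigenvalue a b c lam <-> is_root_eq a b c n lam).
Proof.
  intros Hab Hc Hbal HMdef Hn Hn1 Hn2 lam Hlam.
  (* A zero mean with a < b forces b > 0, so that M, defined with b rather than |b|, does bound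
     |q|. *)
  assert (Hb : 0 < b) by nra.
  assert (HaM : Rabs a <= M) by (rewrite HMdef; apply Rmax_l).
  assert (HbM : b <= M) by (rewrite HMdef; apply Rmax_r).
  assert (HM : 0 < M) by lra.
  assert (Hq : forall x, Rabs (q a b c x) <= M).
  { intros x; unfold q; destruct (Rle_dec x c); [exact HaM | rewrite Rabs_pos_eq; lra]. }
  destruct (spectral_gap n M lam HM Hn Hn1 Hn2 Hlam) as [g [HMg Hgap]].
  assert (Hdd : summable (diagn n lam)) by (apply (diagn_summable n lam g); [lra | exact Hgap]).
  assert (Hbox := a_box_lim a b c M n lam Hc Hq Hdd).
  assert (Hser := ex_series_walk a b c M lam g n Hc HM Hq HMg Hgap).
  set (F := Series (fun k => walk a b c n lam (S k) (Z.of_nat n))).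
  split.
  - intros (y & y' & H1 & H2 & H3 & Hy0 & HyPI & x & Hx & Hyx).
    assert (Hsol : is_solution a b c lam 0 n y y').
    { split; [|split]; try assumption; intros t Ht Htc.
      replace ((q a b c t - lam) * y t - 0 * sin (INR n * t)) with ((q a b c t - lam) * y t)
        by ring.
      now apply H3. }
    assert (E := reduced_equation a b c M lam g n Hc Hbal HM Hq Hn HMg Hgap 0 y y' Hsol Hy0 HyPI).
    exists (fun k => walk a b c n lam k (Z.of_nat n)), F; split; [|split].
    + intros k _; apply Hbox.
    + apply Series_correct, Hser.
    + rewrite Ropp_0 in E; apply Rmult_integral in E; destruct E as [E | E]; [exact E|].
      exfalso; apply Hyx.
      apply (trivial_mode_trivial_solution a b c M lam g n Hc HM Hq Hn HMg Hgap 0 y y' Hsol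
        Hy0 HyPI E x Hx).
  - intros (A & Ssum & HA & HS & HR).
    (* Uniqueness of limits: any admissible values of a_k and of their sum are the ones computed
       from walks. *)
    assert (HAw : forall k, (1 <= k)%nat -> A k = walk a b c n lam k (Z.of_nat n)).
    { intros k Hk; assert (L := is_lim_seq_unique _ _ (HA k Hk)).
      rewrite (is_lim_seq_unique _ _ (Hbox k)) in L; injection L; auto. }
    assert (HF : Ssum = F).
    { rewrite <- (is_series_unique _ _ HS); apply Series_ext; intros k; apply HAw; lia. }
    rewrite HF in HR.
    (* A shooting alternative: either the homogeneous solution [z] with slope 1 at 0 also vanishes
       at [PI] and is an eigenfunction, or a multiple of it corrects the value at [PI] of a solution
       with source sin nx. *)
    destruct (solution_exists a b c lam 0 1 n Hc Hn) as (z & z' & Hz & Hz0 & Hz'0).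
    destruct (Req_dec (z PI) 0) as [HzPI | HzPI].
    { apply (eigenvalue_of_solution a b c lam n z z'); assumption. }
    destruct (solution_exists a b c lam 1 0 n Hc Hn) as (y & y' & Hy & Hy0 & _).
    set (k := y PI / z PI).
    assert (E := reduced_equation a b c M lam g n Hc Hbal HM Hq Hn HMg Hgap 1 _ _
      (solution_combination a b c lam 1 k n y y' z z' Hy Hz)).
    fold F in E; rewrite HR, Rmult_0_l in E.
    (* In the second case [reduced_equation] applies with [tau = 1], and its first factor is 0
       because [lam] is a root. *)
    assert (0 = - (1)); [|lra].
    apply E; [rewrite Hy0, Hz0; ring | unfold k; field; exact HzPI].
Qed.
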